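(* Let $\mathfrak g$ be a $Q$-type Lie superalgebra. Then $\mathcal Z(\hat U)=\mathcal Z(\mathfrak g)$ (as subsets of $\hat U\supset\mathcal U(\mathfrak g)$).
   Context: The base field is $\mathbb C$. For $n\times n$ matrices $A,B$ put $X_{A,B}=\begin{pmatrix}A&B\\ B&A\end{pmatrix}$. The Lie superalgebra $\mathfrak q(n)=\{X_{A,B}\}$ has even part $\{X_{A,0}\}$, odd part $\{X_{0,B}\}$ and brackets $[X_{A,0},X_{A',0}]=X_{[A,A'],0}$, $[X_{A,0},X_{0,B}]=X_{0,[A,B]}$, $[X_{0,B},X_{0,B'}]=X_{BB'+B'B,0}$. Put $\mathfrak{sq}(n)=\{X_{A,B}:\operatorname{tr}B=0\}$, $\mathfrak{pq}(n)=\mathfrak q(n)/\mathbb C\,\mathrm{Id}$, $\mathfrak{psq}(n)=\mathfrak{sq}(n)/\mathbb C\,\mathrm{Id}$. A $Q$-type Lie superalgebra is one of $\mathfrak q(n),\mathfrak{sq}(n)$ ($n\ge 2$), $\mathfrak{pq}(n),\mathfrak{psq}(n)$ ($n\geq 3$). Triangular decomposition $\mathfrak g=\mathfrak n^-\oplus\mathfrak h\oplus\mathfrak n^+$: $\mathfrak h$ (resp. $\mathfrak n^+$, $\mathfrak n^-$) consists of the (images of) $X_{A,B}$ with $A,B$ diagonal (resp. strictly upper triangular, strictly lower triangular); $\mathfrak b^-=\mathfrak h+\mathfrak n^-$. $Q^+=\sum_{\alpha\in\Delta^+}\mathbb Z_{\ge0}\alpha$, where $\Delta^+=\{\varepsilon_i-\varepsilon_j\}_{i<j}$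 are the $\mathfrak h_{\overline 0}$-weights of $\mathfrak n^+$; the height of $\nu=\sum k_i\alpha_i$ ($\alpha_i$ simple) is $\sum k_i$. Completion: for $\nu\in Q^+$ put $J'(\nu)=\mathcal U(\mathfrak b^-)\,\mathcal U(\mathfrak n^+)_\nu$ ($\mathcal U(\mathfrak n^+)_\nu$ is the weight space of weight $\nu$). By PBW, $\mathcal U(\mathfrak g)=\bigoplus_{\nu\in Q^+}J'(\nu)$. $\hat U$ is the completion of $\mathcal U(\mathfrak g)$ whose underlying space is $\hat U=\prod_{\nu\in Q^+}J'(\nu)$; its elements are formal sums $u=\sum_{\nu\in Q^+}u_\nu$, $u_\nu\in J'(\nu)$. The associative algebra structure and the adjoint action of $\mathfrak g$ extend uniquely by continuity from $\mathcal U(\mathfrak g)$ to $\hat U$ (neighbourhoods of zero being elements all of whose components $u_\nu$ of height less than $k$ vanish). $\mathcal Z(\hat U)=\hat U^{\mathfrak g}$ is the (super)centre of $\hat U$ (elements annihilated by the adjoint action of $\mathfrak g$), and $\mathcal Z(\mathfrak g)=\mathcal U(\mathfrak g)^{\mathfrak g}$ is the (super)centre of $\mathcal U(\mathfrak g)$. *)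

(* Defs.v *)
From HB Require Import structures.
From mathcomp Require Import all_boot all_order all_algebra.
From mathcomp Require Import mathcomp_extra boolp classical_sets cardinality.
From mathcomp Require Import fsbigop.
From mathcomp Require Import ring.

Set Implicit Arguments.
Unset Strict Implicit.
Unset Printing Implicit Defensive.

Import GRing.Theory.
Local Open Scope ring_scope.
Local Open Scope quotient_scope.
Local Open Scope classical_set_scope.

Section QuotientLmodule.
Variables (K : pzRingType) (V : lmodType K) (I : submodClosed V).

(* Quotient.quot asks for a predicate that is canonically a zmodClosed. *)
Definition submod_pred : {pred V} := I.

Fact submod_pred_zmod_closed : zmod_closed submod_pred.
Proof.
split=> [|x y xI yI]; first exact: (rpred0 I).
by rewrite -scaleN1r; apply: (rpredD (S := I)) => //; exact: (rpredZ (s := I)).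
Qed.

HB.instance Definition _ :=
  GRing.isZmodClosed.Build V submod_pred submod_pred_zmod_closed.

Local Notation Q := (Quotient.quot submod_pred).

Definition quot_scale (a : K) : Q -> Q := lift_op1 Q ( *:%R a).

Lemma pi_quot_scale a : {morph \pi_Q : x / a *: x >-> quot_scale a x}.
Proof.
move=> x; unlock quot_scale; apply/eqP.
rewrite -Quotient.idealrBE -scalerBr (rpredZ (s := I)) //.
by rewrite -[_ \in _]/(_ \in submod_pred) Quotient.idealrBE reprK.
Qed.

Fact quot_scaleA a b (x : Q) :
  quot_scale a (quot_scale b x) = quot_scale (a * b) x.
Proof. by rewrite -[x]reprK -!pi_quot_scale scalerA. Qed.

Fact quot_scale1 : left_id 1 quot_scale.
Proof. by move=> x; rewrite -[x]reprK -pi_quot_scale scale1r. Qed.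

Fact quot_scaleDr : right_distributive quot_scale +%R.
Proof.
move=> a x y; rewrite -[x]reprK -[y]reprK -raddfD -!pi_quot_scale.
by rewrite scalerDr raddfD.
Qed.

Fact quot_scaleDl (x : Q) : {morph quot_scale^~ x : a b / a + b}.
Proof.
by move=> a b; rewrite -[x]reprK -!pi_quot_scale scalerDl raddfD.
Qed.

HB.instance Definition _ := GRing.Zmodule_isLmodule.Build K Q
  quot_scaleA quot_scale1 quot_scaleDr quot_scaleDl.

Lemma pi_quotD (x y : V) : \pi_Q (x + y) = \pi_Q x + \pi_Q y.
Proof. exact: raddfD. Qed.

Lemma pi_quotN (x : V) : \pi_Q (- x) = - \pi_Q x.
Proof. exact: raddfN. Qed.

Lemma pi_quotZ a (x : V) : \pi_Q (a *: x) = a *: \pi_Q x.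
Proof. exact: pi_quot_scale. Qed.

Lemma quotP (x y : V) : x - y \in I -> \pi_Q x = \pi_Q y.
Proof.
by rewrite -[_ \in _]/(_ \in submod_pred) Quotient.idealrBE => /eqP.
Qed.

Lemma repr_quotP (x : V) : repr (\pi_Q x) - x \in I.
Proof.
by rewrite -[_ \in _]/(_ \in submod_pred) Quotient.idealrBE reprK.
Qed.

End QuotientLmodule.

(* A Lie superalgebra is given by its even and odd parts and by the three     *)
(* homogeneous components of the bracket; the bracket of an odd y with an     *)
(* even x is [y, x] = - [x, y].  In characteristic 0 the axioms below are     *)
(* super-antisymmetry and the super Jacobi identity, parity by parity.        *)
Record lieSuper (K : numFieldType) := LieSuper {
  ls0 : lmodType K;
  ls1 : lmodType K;
  br00 : ls0 -> ls0 -> ls0;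
  br01 : ls0 -> ls1 -> ls1;
  br11 : ls1 -> ls1 -> ls0;
  br00_linear : forall x, linear (br00 x);
  br01_linearl : forall y, linear (br01^~ y);
  br01_linearr : forall x, linear (br01 x);
  br11_linear : forall y, linear (br11 y);
  br00_anti : forall x x', br00 x x' = - br00 x' x;
  br11_sym : forall y y', br11 y y' = br11 y' y;
  jacobi000 : forall x x' x'',
    br00 x (br00 x' x'') = br00 (br00 x x') x'' + br00 x' (br00 x x'');
  jacobi001 : forall x x' y,
    br01 x (br01 x' y) = br01 (br00 x x') y + br01 x' (br01 x y);
  jacobi011 : forall x y y',
    br00 x (br11 y y') = br11 (br01 x y) y' + br11 y (br01 x y');
  jacobi111 : forall y y' y'',
    br01 (br11 y y') y'' + br01 (br11 y' y'') y + br01 (br11 y'' y) y' = 0 }.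

Section CentralQuotient.
Variables (K : numFieldType) (L : lieSuper K) (I : submodClosed (ls0 L)).
Hypothesis I00 : forall x z, z \in I -> br00 x z = 0.
Hypothesis I01 : forall z y, z \in I -> br01 z y = 0.
Local Notation Q := (Quotient.quot (submod_pred I)).

Definition cq00 (x x' : Q) : Q := \pi_Q (br00 (repr x) (repr x')).
Definition cq01 (x : Q) (y : ls1 L) : ls1 L := br01 (repr x) y.
Definition cq11 (y y' : ls1 L) : Q := \pi_Q (br11 y y').

Let br00D x a b : br00 (l := L) x (a + b) = br00 x a + br00 x b.
Proof. by rewrite -[a]scale1r br00_linear !scale1r. Qed.
Let br01D a b y : br01 (l := L) (a + b) y = br01 a y + br01 b y.
Proof. by rewrite -[a]scale1r br01_linearl !scale1r. Qed.

Let shift (x : ls0 L) : exists2 z, z \in I & repr (\pi_Q x) = z + x.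
Proof.
by exists (repr (\pi_Q x) - x); [exact: repr_quotP | rewrite subrK].
Qed.

Let cq01_pi x y : cq01 (\pi_Q x) y = br01 x y.
Proof.
by rewrite /cq01; have [z zI ->] := shift x; rewrite br01D I01 // add0r.
Qed.

Let cq00_pi x x' : cq00 (\pi_Q x) (\pi_Q x') = \pi_Q (br00 x x').
Proof.
rewrite /cq00; have [z zI ->] := shift x; have [z' zI' ->] := shift x'.
by rewrite br00D I00 // add0r br00_anti br00D I00 // add0r -br00_anti.
Qed.

Fact cq00_linear x : linear (cq00 x).
Proof.
move=> a u v; rewrite -[x]reprK -[u]reprK -[v]reprK -pi_quotZ -pi_quotD.
by rewrite !cq00_pi br00_linear pi_quotD pi_quotZ.
Qed.

Fact cq01_linearl y : linear (cq01^~ y).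
Proof.
move=> a u v /=; rewrite -[u]reprK -[v]reprK -pi_quotZ -pi_quotD.
by rewrite !cq01_pi br01_linearl.
Qed.

Fact cq01_linearr x : linear (cq01 x).
Proof. by move=> a u v; exact: br01_linearr. Qed.

Fact cq11_linear y : linear (cq11 y).
Proof. by move=> a u v; rewrite /cq11 br11_linear pi_quotD pi_quotZ. Qed.

Fact cq00_anti x x' : cq00 x x' = - cq00 x' x.
Proof.
by rewrite -[x]reprK -[x']reprK !cq00_pi br00_anti pi_quotN.
Qed.

Fact cq11_sym y y' : cq11 y y' = cq11 y' y.
Proof. by rewrite /cq11 br11_sym. Qed.

Fact cq_jacobi000 x x' x'' :
  cq00 x (cq00 x' x'') = cq00 (cq00 x x') x'' + cq00 x' (cq00 x x'').
Proof.
elim/quotW: x => x; elim/quotW: x' => x'; elim/quotW: x'' => x''.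
rewrite (cq00_pi x' x'') (cq00_pi x x') (cq00_pi x x'').
by rewrite (cq00_pi x) (cq00_pi (br00 x x')) (cq00_pi x') jacobi000 pi_quotD.
Qed.

Fact cq_jacobi001 x x' y :
  cq01 x (cq01 x' y) = cq01 (cq00 x x') y + cq01 x' (cq01 x y).
Proof.
by rewrite -[x]reprK -[x']reprK !cq00_pi !cq01_pi jacobi001.
Qed.

Fact cq_jacobi011 x y y' :
  cq00 x (cq11 y y') = cq11 (cq01 x y) y' + cq11 y (cq01 x y').
Proof.
by rewrite -[x]reprK /cq11 cq00_pi !cq01_pi jacobi011 pi_quotD.
Qed.

Fact cq_jacobi111 y y' y'' :
  cq01 (cq11 y y') y'' + cq01 (cq11 y' y'') y + cq01 (cq11 y'' y) y' = 0.
Proof. by rewrite /cq11 !cq01_pi jacobi111. Qed.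

Definition central_quot : lieSuper K :=
  LieSuper cq00_linear cq01_linearl cq01_linearr cq11_linear cq00_anti
    cq11_sym cq_jacobi000 cq_jacobi001 cq_jacobi011 cq_jacobi111.

End CentralQuotient.

Section Superalgebras.
Variables (K : numFieldType) (n : nat).
Implicit Types A B : 'M[K]_n.

Definition mx_comm A B := A *m B - B *m A.
Definition mx_anti A B := A *m B + B *m A.

Fact mx_comm_linear A : linear (mx_comm A).
Proof.
move=> a u v; rewrite /mx_comm mulmxDr mulmxDl -scalemxAr -scalemxAl.
by rewrite scalerBr opprD addrACA.
Qed.

Fact mx_comm_linearl B : linear (mx_comm^~ B).
Proof.
move=> a u v; rewrite /mx_comm mulmxDr mulmxDl -scalemxAr -scalemxAl.
by rewrite scalerBr opprD addrACA.
Qed.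

Fact mx_anti_linear A : linear (mx_anti A).
Proof.
move=> a u v; rewrite /mx_anti mulmxDr mulmxDl -scalemxAr -scalemxAl.
by rewrite scalerDr addrACA.
Qed.

Fact mx_comm_anti A B : mx_comm A B = - mx_comm B A.
Proof. by rewrite /mx_comm opprB. Qed.

Fact mx_anti_sym A B : mx_anti A B = mx_anti B A.
Proof. by rewrite /mx_anti addrC. Qed.

Fact mx_jacobi A B B' : mx_comm A (mx_comm B B') =
  mx_comm (mx_comm A B) B' + mx_comm B (mx_comm A B').
Proof.
rewrite /mx_comm !(mulmxBl, mulmxBr) !mulmxA.
move: (A *m B *m B') (A *m B' *m B) (B *m A *m B') (B *m B' *m A)
  (B' *m A *m B) (B' *m B *m A) => a b c d e f.
by apply/matrixP=> i j; rewrite !mxE; ring.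
Qed.

Fact mx_jacobi011 A B B' : mx_comm A (mx_anti B B') =
  mx_anti (mx_comm A B) B' + mx_anti B (mx_comm A B').
Proof.
rewrite /mx_comm /mx_anti !(mulmxDl, mulmxDr, mulNmx, mulmxN) !mulmxA.
move: (A *m B *m B') (A *m B' *m B) (B *m A *m B') (B *m B' *m A)
  (B' *m A *m B) (B' *m B *m A) => a b c d e f.
by apply/matrixP=> i j; rewrite !mxE; ring.
Qed.

Fact mx_jacobi111 A B B' :
  mx_comm (mx_anti A B) B' + mx_comm (mx_anti B B') A
    + mx_comm (mx_anti B' A) B = 0.
Proof.
rewrite /mx_comm /mx_anti !(mulmxDl, mulmxDr, mulNmx, mulmxN) !mulmxA.
move: (A *m B *m B') (A *m B' *m B) (B *m A *m B') (B *m B' *m A)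
  (B' *m A *m B) (B' *m B *m A) => a b c d e f.
by apply/matrixP=> i j; rewrite !mxE; ring.
Qed.

(* The supercommutators of the block matrices X_{A,B} = (A B; B A), where     *)
(* X_{A,0} is encoded by A and X_{0,B} by B.                                  *)
Definition q_alg : lieSuper K :=
  @LieSuper K 'M[K]_n 'M[K]_n mx_comm mx_comm mx_anti
    mx_comm_linear mx_comm_linearl mx_comm_linear mx_anti_linear
    mx_comm_anti mx_anti_sym mx_jacobi mx_jacobi mx_jacobi011 mx_jacobi111.

Definition sl_space : {vspace 'M[K]_n} :=
  lker (linfun (@mxtrace K n : 'M[K]_n -> K^o)).

Lemma sl_spaceP B : (B \in sl_space) = (\tr B == 0).
Proof. by rewrite memv_ker lfunE. Qed.

Fact mx_comm_sl A B : mx_comm A B \in sl_space.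
Proof. by rewrite sl_spaceP /mx_comm linearB /= mxtrace_mulC subrr. Qed.

Implicit Types Y : subvs_of sl_space.

Definition sq01 A Y : subvs_of sl_space :=
  Subvs (mx_comm_sl A (vsval Y)).
Definition sq11 Y Y' : 'M[K]_n :=
  mx_anti (vsval Y) (vsval Y').

Fact sq01_linearl Y : linear (sq01^~ Y).
Proof. by move=> a u v; apply: val_inj; exact: mx_comm_linearl. Qed.

Fact sq01_linearr A : linear (sq01 A).
Proof. by move=> a u v; apply: val_inj; exact: mx_comm_linear. Qed.

Fact sq11_linear Y : linear (sq11 Y).
Proof. by move=> a u v; exact: mx_anti_linear. Qed.

Fact sq11_sym Y Y' : sq11 Y Y' = sq11 Y' Y.
Proof. exact: mx_anti_sym. Qed.

Fact sq_jacobi001 A A' Y :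
  sq01 A (sq01 A' Y) = sq01 (mx_comm A A') Y + sq01 A' (sq01 A Y).
Proof. by apply: val_inj; exact: mx_jacobi. Qed.

Fact sq_jacobi011 A Y Y' :
  mx_comm A (sq11 Y Y') = sq11 (sq01 A Y) Y' + sq11 Y (sq01 A Y').
Proof. exact: mx_jacobi011. Qed.

Fact sq_jacobi111 Y Y' Y'' :
  sq01 (sq11 Y Y') Y'' + sq01 (sq11 Y' Y'') Y + sq01 (sq11 Y'' Y) Y' = 0.
Proof. by apply: val_inj; exact: mx_jacobi111. Qed.

Definition sq_alg : lieSuper K :=
  @LieSuper K 'M[K]_n (subvs_of sl_space) mx_comm sq01 sq11
    mx_comm_linear sq01_linearl sq01_linearr sq11_linear
    mx_comm_anti sq11_sym mx_jacobi sq_jacobi001 sq_jacobi011 sq_jacobi111.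

Definition Id_line : submodClosed 'M[K]_n := <[1%:M : 'M[K]_n]>%VS.

Fact Id_comm A B : B \in Id_line -> mx_comm A B = 0.
Proof.
by move=> /vlineP[a ->]; rewrite /mx_comm scalemx1 scalar_mxC subrr.
Qed.

Fact Id_comml A B : A \in Id_line -> mx_comm A B = 0.
Proof. by move=> AI; rewrite mx_comm_anti Id_comm ?oppr0. Qed.

Fact Id_sq01 A Y : A \in Id_line -> sq01 A Y = 0.
Proof. by move=> AI; apply: val_inj; exact: Id_comml. Qed.

Definition pq_alg : lieSuper K :=
  @central_quot K q_alg Id_line Id_comm Id_comml.

Definition psq_alg : lieSuper K :=
  @central_quot K sq_alg Id_line Id_comm Id_sq01.

End Superalgebras.

Variant qtype := Tq | Tsq | Tpq | Tpsq.

Definition qtype_min (t : qtype) : nat :=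
  match t with Tq | Tsq => 2 | Tpq | Tpsq => 3 end.

Definition qtype_alg (K : numFieldType) (t : qtype) (n : nat) : lieSuper K :=
  match t with
  | Tq => q_alg K n
  | Tsq => sq_alg K n
  | Tpq => pq_alg K n
  | Tpsq => psq_alg K n
  end.

(* The image of X_{A,0} in the even part. *)
Definition Xeven (K : numFieldType) (t : qtype) (n : nat) :
    'M[K]_n -> ls0 (qtype_alg K t n) :=
  match t with
  | Tq | Tsq => fun A => A
  | Tpq | Tpsq => fun A => \pi_(Quotient.quot (submod_pred (Id_line K n))) A
  end.

(* The matrix B of an odd element X_{0,B}; the quotients do not affect it. *)
Definition Xodd (K : numFieldType) (t : qtype) (n : nat) :
    ls1 (qtype_alg K t n) -> 'M[K]_n :=
  match t with
  | Tq | Tpq => fun B => B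
  | Tsq | Tpsq => fun B => vsval B
  end.

Section Enveloping.
Variables (K : numFieldType) (L : lieSuper K).

Definition lie_super_map (A : algType K)
    (j0 : {linear ls0 L -> A}) (j1 : {linear ls1 L -> A}) : Prop :=
  [/\ forall x x', j0 (br00 x x') = j0 x * j0 x' - j0 x' * j0 x,
      forall x y, j1 (br01 x y) = j0 x * j1 y - j1 y * j0 x &
      forall y y', j0 (br11 y y') = j1 y * j1 y' + j1 y' * j1 y].

(* The universal enveloping algebra, through its universal property. *)
Record envelope := Envelope {
  env_alg :> algType K;
  env0 : {linear ls0 L -> env_alg};
  env1 : {linear ls1 L -> env_alg};
  env_map : lie_super_map env0 env1;
  env_lift : forall (A : algType K)
      (j0 : {linear ls0 L -> A}) (j1 : {linear ls1 L -> A}),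
    lie_super_map j0 j1 ->
    exists f : {lrmorphism env_alg -> A},
      (forall x, f (env0 x) = j0 x) /\ (forall y, f (env1 y) = j1 y);
  env_ext : forall (A : algType K) (f g : {lrmorphism env_alg -> A}),
    (forall x, f (env0 x) = g (env0 x)) ->
    (forall y, f (env1 y) = g (env1 y)) -> f =1 g }.

Variable U : envelope.
Local Notation i0 := (env0 U).
Local Notation i1 := (env1 U).

Lemma env_parity_subproof : exists f : {lrmorphism U -> U},
  (forall x, f (i0 x) = i0 x) /\ (forall y, f (i1 y) = - i1 y).
Proof.
have [r00 r01 r11] := env_map U.
apply: (@env_lift U U i0 (\- i1)); split=> [//|x y|y y'] /=.
- by rewrite r01 mulrN mulNr opprB opprK addrC.
- by rewrite r11 !mulrNN.
Qed.

(* The grading involution u |-> (-1)^|u| u of the superalgebra U. *)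
Definition env_parity : {lrmorphism U -> U} :=
  projT1 (cid env_parity_subproof).

(* The adjoint action: x u - u x for x even, and for y odd the operator       *)
(* given by y u - (-1)^|u| u y on homogeneous u.                              *)
Definition ad0 (x : ls0 L) (u : U) : U := i0 x * u - u * i0 x.
Definition ad1 (y : ls1 L) (u : U) : U := i1 y * u - env_parity u * i1 y.

Definition env_center : set U :=
  [set u | (forall x, ad0 x u = 0) /\ (forall y, ad1 y u = 0)].

End Enveloping.

Inductive gen_alg (K : numFieldType) (A : algType K) (S : set A) : set A :=
| gen_alg_in u of S u : gen_alg S u
| gen_alg_1 : gen_alg S 1
| gen_algD u v of gen_alg S u & gen_alg S v : gen_alg S (u + v)
| gen_algZ a u of gen_alg S u : gen_alg S (a *: u)
| gen_algM u v of gen_alg S u & gen_alg S v : gen_alg S (u * v).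

Section RootLattice.
Variable n : nat.

(* Q^+ is freely generated by the simple roots eps_i - eps_(i+1); an element  *)
(* is given by its coefficients.                                              *)
Definition Qplus := {ffun 'I_n.-1 -> nat}.

Definition height (nu : Qplus) : nat := (\sum_i nu i)%N.

Definition ord_lo (i : 'I_n.-1) : 'I_n := widen_ord (leq_pred n) i.

Fact ord_hi_subproof (i : 'I_n.-1) : (i.+1 < n)%N.
Proof. by rewrite -ltn_predRL. Qed.

Definition ord_hi (i : 'I_n.-1) : 'I_n := Ordinal (ord_hi_subproof i).

(* The value of nu at the diagonal matrix A. *)
Definition weight (K : numFieldType) (nu : Qplus) (A : 'M[K]_n) : K :=
  \sum_i (A (ord_lo i) (ord_lo i) - A (ord_hi i) (ord_hi i)) *+ nu i.

End RootLattice.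

Section Completion.
Variables (K : numFieldType) (t : qtype) (n : nat).
Local Notation L := (qtype_alg K t n).
Variable U : envelope L.

Definition diag_mat (A : 'M[K]_n) : Prop :=
  forall i j : 'I_n, i != j -> A i j = 0.
Definition strict_upper (A : 'M[K]_n) : Prop :=
  forall i j : 'I_n, (j <= i)%N -> A i j = 0.
Definition strict_lower (A : 'M[K]_n) : Prop :=
  forall i j : 'I_n, (i <= j)%N -> A i j = 0.

(* The image in U of the homogeneous elements X_{A,0}, X_{0,B} of the         *)
(* superalgebra with A, B satisfying P.                                       *)
Definition Ximage (P : 'M[K]_n -> Prop) : set U :=
  [set env0 U (Xeven t A) | A in P] `|` [set env1 U y | y in P \o @Xodd K t n].

Definition U_bminus : set U :=
  gen_alg (Ximage diag_mat `|` Ximage strict_lower).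
Definition U_nplus : set U := gen_alg (Ximage strict_upper).

Definition U_nplus_weight (nu : Qplus n) : set U :=
  [set u | U_nplus u /\ forall A : 'M[K]_n, diag_mat A ->
     ad0 (Xeven t A) u = weight nu A *: u].

Definition Jprime (nu : Qplus n) : set U :=
  [set u | exists m (b a : 'I_m -> U),
     [/\ forall i, U_bminus (b i), forall i, U_nplus_weight nu (a i) &
         u = \sum_i b i * a i]].

(* An element of the completion is the family of its components. *)
Definition hatU : set (Qplus n -> U) := [set u | forall nu, Jprime nu (u nu)].

(* u is the image in hatU of the element x of U. *)
Definition hat_embed (x : U) (u : Qplus n -> U) : Prop :=
  [/\ hatU u, finite_set [set nu | u nu != 0] &
      x = \sum_(nu \in [set: Qplus n]) u nu].

(* A finite sum: there are finitely many nu of bounded height. *)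
Definition hat_trunc (k : nat) (u : Qplus n -> U) : U :=
  \sum_(nu \in [set nu : Qplus n | (height nu < k)%N]) u nu.

(* The sequence x of elements of U converges to v in hatU. *)
Definition hat_cvg (x : nat -> U) (v : Qplus n -> U) : Prop :=
  forall k, exists N, forall m, (N <= m)%N ->
    exists2 w, hat_embed (x m) w & forall nu, (height nu < k)%N -> w nu = v nu.

(* v is the value at u of the continuous extension to hatU of T : U -> U. *)
Definition hat_extends (T : U -> U) (u v : Qplus n -> U) : Prop :=
  hatU v /\ hat_cvg (fun k => T (hat_trunc k u)) v.

Definition hat_center : set (Qplus n -> U) :=
  [set u | [/\ hatU u,
     forall x, hat_extends (ad0 x) u (fun=> 0) &
     forall y, hat_extends (ad1 y) u (fun=> 0)]].

End Completion.

Arguments env_center {K L} U _.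
Arguments hatU {K t n} U _.
Arguments hat_embed {K t n U} x u.
Arguments hat_center {K t n} U _.

(* Main.v *)
(* Let z = sum_nu z_nu be central in the completion.  Since z commutes with    *)
(* n^+, for e in n^+ the component of [e, z] of weight nu vanishes; it is      *)
(* D_e(z_nu) plus terms coming from the z_mu with mu < nu.  Passing to top     *)
(* symbols, D_e becomes the derivation of S(b^-) = S(g)/(n^+) induced by       *)
(* ad e.  No nonzero element of S(b^-) of nonzero weight is killed by all      *)
(* these derivations: for a root vector y of n^- and the opposite root vector  *)
(* e of n^+ of the same parity, [e, y] is E_ii - E_jj or E_ii + E_jj, which    *)
(* does not vanish in h (for the latter in pq(n), psq(n) this needs n >= 3).   *)
(* Hence the degree of z_nu is at most that of z_0, and since a monomial of    *)
(* weight nu in U(n^+) has degree at least height(nu)/(n-1), almost all z_nu   *)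
(* vanish.  A central element of finite support lies in the centre of U(g).    *)
(*                                                                             *)
(* The Poincare-Birkhoff-Witt theorem needed for symbols is proved by duality: *)
(* linear forms on U(g) form a supercommutative algebra, and monomials in      *)
(* forms that are coordinates on g, obtained here as matrix coefficients, are  *)
(* triangular with respect to the ordered monomials of U(g).                   *)

Require Import Defs.
From HB Require Import structures.
From mathcomp Require Import all_boot all_order all_algebra.
From mathcomp Require Import mathcomp_extra boolp classical_sets functions cardinality.
From mathcomp Require Import fsbigop.
From mathcomp Require Import reals complex.
From mathcomp Require Import ring zify.

Set Implicit Arguments.
Unset Strict Implicit.
Unset Printing Implicit Defensive.

Import GRing.Theory Num.Theory Order.TTheory.
Local Open Scope ring_scope.
Local Open Scope quotient_scope.

(** * Duality for words *)

(** A central element of U(g) is central in the completion because its truncations are eventually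
    constant ([hat_center_sup]). Conversely, it suffices that a central [u] of the completion has
    finitely many nonzero components ([hat_center_bounded]): then a truncation is the whole sum, and
    its brackets, as constant sequences tending to zero, vanish ([hat_center_sub]).

    Finiteness is a leading-monomial argument. Take a basis of matrix letters, ordered so that those
    of n^+ come last: a standard word is a b^- word followed by an n^+ word, and the weight of the
    latter names the summand J'(nu) ([Jprime_span]). Invariance under the diagonal matrices forces
    every word occurring in [u] to have weight zero ([zc_weight]), so a word of positive height
    contains a lower letter [y] ([zc_lower]). Let [d] be the greatest length in height 0, and
    suppose that longer words occur; consider the least height where they do, the longest words
    there, and among these a word [w] of least [wstat]. Bracketing with the upper letter [a]
    opposite to [y] can replace [y] by a diagonal letter, which keeps length and height. For a
    suitable diagonal letter the resulting word [w'] is reached from no other word of [u]: higher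
    components do not come down under n^+ ([adw_ge_height]), lower ones are too short, and
    [adw_leading] treats those of equal height. So [w'] occurs in the bracket of [a] and [u], which
    is absurd. Lengths are therefore bounded ([size_bound]), hence heights too ([graded_finite]).

    Coefficients make sense because standard words are independent ([pbw_free]). As U(g) is known
    only through its universal property, separating linear forms have to be built. Functions on
    words that respect the relations ([wrel]) carry an action of U(g) and so define forms
    ([wrel_functional]). They are closed under a signed shuffle product ([wrel_mul]), and monomials
    in the coordinate functions [word_coord] are triangular against standard words ([wmonom_cont],
    [wmonom_diag]). *)

Lemma linear_comb (K : pzRingType) (V W : lmodType K) (T : V -> W)
    (I : Type) (r : seq I) (C : pred I) (z : I -> K) (f : I -> V) :
  linear T ->
  T (\sum_(i <- r | C i) z i *: f i) = \sum_(i <- r | C i) z i *: T (f i).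
Proof.
move=> Tl; rewrite -big_filter -[RHS]big_filter; elim: (filter _ _) => [|i s IH].
  by rewrite !big_nil; have := Tl (-1) 0 0; rewrite scaler0 addr0 scaleN1r addNr.
by rewrite !big_cons Tl IH.
Qed.

(** * Linear endomorphisms as an algebra, a target for the universal property *)

Section Endomorphisms.
Variables (K : numFieldType) (V : lmodType K) (v0 : V) (v0N0 : v0 != 0).

(* The parameter [v0N0] ensures [1 != 0], which [algType] requires.           *)
Definition endo of v0 != 0 := {f : V -> V | `[<linear f>]}.
Local Notation E := (endo v0N0).

HB.instance Definition _ := SubType.copy E {f : V -> V | `[<linear f>]}.
HB.instance Definition _ := gen_eqMixin E.
HB.instance Definition _ := gen_choiceMixin E.

Definition endo_fun (f : E) : V -> V := val f.
Local Coercion endo_fun : endo >-> Funclass.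

Lemma endoP (f : E) : linear f.
Proof. by apply/asboolP; exact: (valP f). Qed.

Definition mk_endo (f : V -> V) (fl : linear f) : E :=
  exist _ f (asboolT fl).

Lemma endo_eq (f g : E) : f =1 g -> f = g.
Proof. by move=> fg; apply: val_inj; apply/funext. Qed.

Fact endo0_linear : linear (fun _ : V => 0 : V).
Proof. by move=> a x y; rewrite scaler0 addr0. Qed.
Fact endoN_linear (f : E) : linear (fun x => - f x).
Proof. by move=> a x y; rewrite endoP opprD scalerN. Qed.
Fact endoD_linear (f g : E) : linear (fun x => f x + g x).
Proof. by move=> a x y; rewrite !endoP scalerDr addrACA. Qed.
Fact endoZ_linear k (f : E) : linear (fun x => k *: f x).
Proof. by move=> a x y; rewrite endoP scalerDr !scalerA mulrC. Qed.
Fact endo1_linear : linear (fun x : V => x).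
Proof. by []. Qed.
Fact endoM_linear (f g : E) : linear (fun x => f (g x)).
Proof. by move=> a x y; rewrite !endoP. Qed.

Let add f g := mk_endo (endoD_linear f g).
Let opp f := mk_endo (endoN_linear f).
Let zero := mk_endo endo0_linear.
Let one := mk_endo endo1_linear.
Let mul f g := mk_endo (endoM_linear f g).
Let scale k f := mk_endo (endoZ_linear k f).

Fact endo_addA : associative add.
Proof. by move=> f g h; apply: endo_eq => x; exact: addrA. Qed.
Fact endo_addC : commutative add.
Proof. by move=> f g; apply: endo_eq => x; exact: addrC. Qed.
Fact endo_add0 : left_id zero add.
Proof. by move=> f; apply: endo_eq => x; exact: add0r. Qed.
Fact endo_addN : left_inverse zero opp add.
Proof. by move=> f; apply: endo_eq => x; exact: addNr. Qed.
HB.instance Definition _ :=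
  GRing.isZmodule.Build E endo_addA endo_addC endo_add0 endo_addN.

Fact endo_mulA : associative mul.
Proof. by move=> f g h; apply: endo_eq. Qed.
Fact endo_mul1 : left_id one mul.
Proof. by move=> f; apply: endo_eq. Qed.
Fact endo_mulr1 : right_id one mul.
Proof. by move=> f; apply: endo_eq. Qed.
Fact endo_mulDl : left_distributive mul +%R.
Proof. by move=> f g h; apply: endo_eq. Qed.
Fact endo_mulDr : right_distributive mul +%R.
Proof.
move=> f g h; apply: endo_eq => x.
by have := endoP f 1 (g x) (h x); rewrite !scale1r.
Qed.
Fact endo_1N0 : one != 0.
Proof.
apply/eqP => /(congr1 (fun f : E => f v0)) v00.
by move/eqP: v0N0; apply.
Qed.
HB.instance Definition _ := GRing.Zmodule_isNzRing.Build E
  endo_mulA endo_mul1 endo_mulr1 endo_mulDl endo_mulDr endo_1N0.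

Fact endo_scaleA a b f : scale a (scale b f) = scale (a * b) f.
Proof. by apply: endo_eq => x; exact: scalerA. Qed.
Fact endo_scale1 : left_id 1 scale.
Proof. by move=> f; apply: endo_eq => x; exact: scale1r. Qed.
Fact endo_scaleDr : right_distributive scale +%R.
Proof. by move=> a f g; apply: endo_eq => x; exact: scalerDr. Qed.
Fact endo_scaleDl f : {morph scale^~ f : a b / a + b}.
Proof. by move=> a b; apply: endo_eq => x; exact: scalerDl. Qed.
HB.instance Definition _ := GRing.Zmodule_isLmodule.Build K E
  endo_scaleA endo_scale1 endo_scaleDr endo_scaleDl.

Fact endo_scaleAl (a : K) (f g : E) : a *: (f * g) = (a *: f) * g.
Proof. by apply: endo_eq. Qed.
HB.instance Definition _ := GRing.Lmodule_isLalgebra.Build K E endo_scaleAl.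
Fact endo_scaleAr (a : K) (f g : E) : a *: (f * g) = f * (a *: g).
Proof.
apply: endo_eq => x.
have f0 : f 0 = 0.
  have := endoP f 1 0 0; rewrite !scale1r addr0.
  by move/(congr1 (fun z => z - f 0)); rewrite subrr addrK.
by have := endoP f a (g x) 0; rewrite !addr0 f0 addr0.
Qed.
HB.instance Definition _ := GRing.Lalgebra_isAlgebra.Build K E endo_scaleAr.

Lemma endoDE (f g : E) x : endo_fun (f + g) x = f x + g x. Proof. by []. Qed.
Lemma endoNE (f : E) x : endo_fun (- f) x = - f x. Proof. by []. Qed.
Lemma endoZE k (f : E) x : endo_fun (k *: f) x = k *: f x. Proof. by []. Qed.
Lemma endoME (f g : E) x : endo_fun (f * g) x = f (g x). Proof. by []. Qed.
Lemma endo_sumE (I : Type) (r : seq I) (F : I -> E) x :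
  endo_fun (\sum_(i <- r) F i) x = \sum_(i <- r) F i x.
Proof. by elim/big_rec2: _ => // i y z _ <-. Qed.

End Endomorphisms.

(** * Linear forms as functions on words, their product and their monomials *)

Section WordFunctions.
Variables (K : numFieldType) (X : finType) (par : X -> bool).
Variable c : X -> X -> X -> K.
Hypothesis c_par : forall a b k, c a b k != 0 -> par k = par a (+) par b.

Local Notation F := (seq X -> K^o).
Implicit Types (f g : F) (u v w : seq X) (a b i : X).

Definition word_sign a b : K := (-1) ^+ (par a && par b).

(* [f w] stands for the value of a linear form at the product of the letters  *)
(* of [w] in reverse order, so that shifting off the first letter is a left   *)
(* action.                                                                    *)
Definition wrel f : Prop := forall u v a b,
  f (u ++ b :: a :: v) - word_sign a b * f (u ++ a :: b :: v) =
  \sum_k c a b k * f (u ++ k :: v).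

Definition wpar w : bool := odd (count par w).
Definition wtwist (p : bool) f : F := fun w => (-1) ^+ (p && wpar w) * f w.
Definition wshift a f : F := fun w => f (a :: w).

(** A signed shuffle product, forced by the requirement that each letter act through [wshift] as a
    superderivation; the twist is the Koszul sign for moving the letter across [f]. *)
Fixpoint wmul f g w : K^o :=
  if w is a :: w' then
    wmul (wshift a f) g w' + wmul (wtwist (par a) f) (wshift a g) w'
  else f [::] * g [::].

Lemma wmul0l g w : wmul 0 g w = 0.
Proof.
elim: w g => [|a w IH] g /=; first by rewrite mul0r.
have -> : wshift a 0 = 0 by [].
have -> : wtwist (par a) 0 = 0 by apply/funext => v; rewrite /wtwist mulr0.
by rewrite !IH addr0.
Qed.

Lemma wmul0r f w : wmul f 0 w = 0.
Proof.
elim: w f => [|a w IH] f /=; first by rewrite mulr0.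
have -> : wshift a 0 = 0 by [].
by rewrite !IH addr0.
Qed.

Lemma wmulDl k f f' g w :
  wmul (k *: f + f') g w = k * wmul f g w + wmul f' g w.
Proof.
elim: w f f' g => [|a w IH] f f' g /=; first by rewrite mulrDl -mulrA.
have -> : wshift a (k *: f + f') = k *: wshift a f + wshift a f' by [].
have -> : wtwist (par a) (k *: f + f') =
    k *: wtwist (par a) f + wtwist (par a) f'.
  by apply/funext => v; rewrite /wtwist !fctE /= mulrDr mulrCA.
by rewrite !IH mulrDr addrACA.
Qed.

Lemma wmulDr k f g g' w :
  wmul f (k *: g + g') w = k * wmul f g w + wmul f g' w.
Proof.
elim: w f g g' => [|a w IH] f g g' /=; first by rewrite mulrDr mulrCA.
have -> : wshift a (k *: g + g') = k *: wshift a g + wshift a g' by [].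
by rewrite !IH mulrDr addrACA.
Qed.

Lemma wmul_suml (I : Type) (r : seq I) (k : I -> K) (f : I -> F) g w :
  wmul (\sum_(i <- r) k i *: f i) g w = \sum_(i <- r) k i * wmul (f i) g w.
Proof.
elim: r => [|i r IH]; first by rewrite !big_nil wmul0l.
by rewrite !big_cons wmulDl IH.
Qed.

Lemma wmul_sumr (I : Type) (r : seq I) (k : I -> K) f (g : I -> F) w :
  wmul f (\sum_(i <- r) k i *: g i) w = \sum_(i <- r) k i * wmul f (g i) w.
Proof.
elim: r => [|i r IH]; first by rewrite !big_nil wmul0r.
by rewrite !big_cons wmulDr IH.
Qed.

Lemma wtwistM p q f : wtwist p (wtwist q f) = wtwist (p (+) q) f.
Proof.
apply/funext => v; rewrite /wtwist mulrA -signr_addb; congr (_ ^+ _ * _).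
by case: p q (wpar v) => [] [] [].
Qed.

Lemma wshift_twist a p f :
  wshift a (wtwist p f) = (-1) ^+ (p && par a) *: wtwist p (wshift a f).
Proof.
apply/funext => v; rewrite /wtwist /wshift /= !fctE /GRing.scale /=.
rewrite mulrA -signr_addb /wpar /= oddD oddb.
by congr (_ ^+ _ * _); case: p (par a) (odd _) => [] [] [].
Qed.

Lemma wrel_shift a f : wrel f -> wrel (wshift a f).
Proof. by move=> ff u; apply: (ff (a :: u)). Qed.

Lemma wrel_twist p f : wrel f -> wrel (wtwist p f).
Proof.
move=> ff u v a b; rewrite /wtwist.
have wE z : wpar (u ++ z ++ v) = wpar z (+) (wpar u (+) wpar v).
  by rewrite /wpar !count_cat !oddD addbCA.
have w1 := wE [:: b; a]; have w2 := wE [:: a; b].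
rewrite /= in w1 w2; rewrite w1 w2.
have -> : wpar [:: a; b] = wpar [:: b; a] by rewrite /wpar /= !addn0 addnC.
rewrite mulrCA -mulrBr ff mulr_sumr; apply: eq_bigr => k _.
rewrite mulrCA; have [->|c0] := eqVneq (c a b k) 0; first by rewrite !mul0r.
congr (_ * (_ * _)); have /= -> := wE [:: k].
have -> // : wpar [:: k] = wpar [:: b; a].
by rewrite /wpar /= !addn0 oddD !oddb (c_par c0) addbC.
Qed.

Lemma wrelE f a b : wrel f ->
  wshift a (wshift b f) =
  \sum_k c a b k *: wshift k f + word_sign a b *: wshift b (wshift a f).
Proof.
move=> ff; apply/funext => v; rewrite fctE fct_sumE.
by rewrite -[LHS](subrK (word_sign a b * f (a :: b :: v))) (ff [::] v a b).
Qed.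

(* Products of functions on words are dual to the coproduct of the           *)
(* enveloping superalgebra, for which the letters are primitive.             *)
Lemma wrel_mul f g : wrel f -> wrel g -> wrel (wmul f g).
Proof.
move=> ff gg u; elim: u f g ff gg => [|d u IH] f g ff gg v a b; last first.
  rewrite !cat_cons /= mulrDr opprD addrACA !IH;
    do ?[exact: wrel_shift | exact: wrel_twist | by []].
  by rewrite -big_split /=; apply: eq_bigr => k _; rewrite mulrDr.
rewrite !cat0s /= (wrelE a b ff) (wrelE a b gg).
set s := word_sign a b.
have s2 : s * s = 1 by rewrite /s /word_sign -signr_addb addbb.
have ba : (-1) ^+ (par b && par a) = s by rewrite /s /word_sign andbC.
have lin k h h' : wmul (k *: h) h' v = k * wmul h h' v.
  by rewrite -[k *: h]addr0 wmulDl wmul0l addr0.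
have linD h1 h2 h' : wmul (h1 + h2) h' v = wmul h1 h' v + wmul h2 h' v.
  by rewrite -[h1]scale1r wmulDl mul1r scale1r.
have linr k h h' : wmul h (k *: h') v = k * wmul h h' v.
  by rewrite -[k *: h']addr0 wmulDr wmul0r addr0.
have linDr h1 h2 h' : wmul h' (h1 + h2) v = wmul h' h1 v + wmul h' h2 v.
  by rewrite -[h1]scale1r wmulDr mul1r scale1r.
rewrite !wshift_twist !linD !linDr !lin !linr !wtwistM wmul_suml wmul_sumr.
rewrite ba [par b (+) par a]addbC -/(word_sign a b) -/s.
under [RHS]eq_bigr => k _ do rewrite mulrDr.
rewrite big_split /=.
(* Brackets respect parity, so the twist is the same for every contributing [k]. *)
have -> : \sum_k c a b k * wmul (wtwist (par k) f) (wshift k g) v =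
    \sum_k c a b k * wmul (wtwist (par a (+) par b) f) (wshift k g) v.
  apply: eq_bigr => k _; have [->|c0] := eqVneq (c a b k) 0.
    by rewrite !mul0r.
  by rewrite (c_par c0).
set A := \sum_k _; set B := \sum_k _.
set x := wmul (wshift b (wshift a f)) g v.
set y := wmul _ _ v; set z := wmul _ _ v; set t := wmul _ _ v.
(* Apart from the brackets everything cancels; [y] survives with the factor 1 - s^2, which is
   zero. *)
have -> : (A + s * x + y + (s * z + (B + s * t)) -
  s * (x + z + (s * y + t))) = A + B + (1 - s * s) * y by ring.
by rewrite s2 subrr mul0r addr0.
Qed.

(** The analogue of a power series without terms of degree below [d]; orders add under [wmul]. *)
Definition word_ord f d := forall v, (size v < d)%N -> f v = 0.

Lemma word_ord_shift a f d : word_ord f d -> word_ord (wshift a f) d.-1.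
Proof. by move=> fd v vd; apply: fd => /=; lia. Qed.

Lemma word_ord_twist p f d : word_ord f d -> word_ord (wtwist p f) d.
Proof. by move=> fd v vd; rewrite /wtwist fd ?mulr0. Qed.

Lemma word_ord_mul f g p q :
  word_ord f p -> word_ord g q -> word_ord (wmul f g) (p + q).
Proof.
move=> fp gq v; elim: v f g p q fp gq => [|a v IH] f g p q fp gq /= vpq.
  have [p0|p0] := posnP p; last by rewrite fp ?mul0r.
  by rewrite gq ?mulr0 // -(add0n q) -p0.
rewrite (IH _ _ _ _ (word_ord_shift a fp) gq); last by lia.
rewrite (IH _ _ _ _ (word_ord_twist (par a) fp) (word_ord_shift a gq)) ?addr0 //.
by lia.
Qed.

(** The analogue of a power series whose terms of degree at most [size m] are all multiples of the
    monomial [m]. *)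
Definition word_cont f m :=
  forall v, (size v <= size m)%N -> ~~ perm_eq v m -> f v = 0.

Lemma word_cont_ord f m : word_cont f m -> word_ord f (size m).
Proof.
move=> fm v vm; apply: fm; first exact: ltnW.
by apply: contraL vm => /perm_size ->; rewrite ltnn.
Qed.

Lemma word_cont_twist p f m : word_cont f m -> word_cont (wtwist p f) m.
Proof. by move=> fm v vm vp; rewrite /wtwist fm ?mulr0. Qed.

Lemma word_cont_shift a f m : a \in m ->
  word_cont f m -> word_cont (wshift a f) (rem a m).
Proof.
move=> am fm v vm vp; apply: fm.
  by rewrite /= (perm_size (perm_to_rem am)) /= ltnS.
apply: contra vp => vp.
by rewrite -(perm_cons a) (permPl vp) perm_to_rem.
Qed.

Lemma word_cont_shiftN a f m : a \notin m ->
  word_cont f m -> word_ord (wshift a f) (size m).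
Proof.
move=> am fm v vm; apply: fm => //.
by apply: contra am => /perm_mem <-; rewrite mem_head.
Qed.

Lemma word_cont_mul f g m m' :
  word_cont f m -> word_cont g m' -> word_cont (wmul f g) (m ++ m').
Proof.
move=> fm gm v; elim: v f g m m' fm gm => [|a v IH] f g m m' fm gm /=.
  have nilN (b : X) s : ~~ perm_eq [::] (b :: s).
    by apply/negP => /perm_size.
  move=> _; case: m fm => [|b m] fm /= p; last by rewrite (fm [::]) ?mul0r.
  by rewrite (gm [::]) ?mulr0.
rewrite size_cat => vs vp; rewrite [X in X + _](_ : _ = 0) ?add0r.
  have [am|am] := boolP (a \in m').
    apply: (IH _ _ m (rem a m')); first exact: word_cont_twist.
    - exact: word_cont_shift.
    - by have := perm_size (perm_to_rem am); rewrite size_cat /=; lia.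
    apply: contra vp => vp; rewrite -(perm_cons a) in vp.
    by rewrite (permPl vp) -cat1s perm_catCA perm_cat2l /= perm_sym perm_to_rem.
  have o1 := word_cont_ord (word_cont_twist (par a) fm).
  by apply: (word_ord_mul o1 (word_cont_shiftN am gm)).
have [am|am] := boolP (a \in m).
  apply: (IH _ _ (rem a m) m') => //; first exact: word_cont_shift.
    by have := perm_size (perm_to_rem am); rewrite size_cat /=; lia.
  apply: contra vp => vp; rewrite -(perm_cons a) in vp.
  by rewrite (permPl vp) -cat_cons perm_cat2r perm_sym perm_to_rem.
by apply: (word_ord_mul (word_cont_shiftN am fm) (word_cont_ord gm)).
Qed.

Definition weps : F := fun w => (w == [::])%:R.

Lemma wmul_eps g w : wmul weps g w = g w.
Proof.
elim: w g => [|a w IH] g /=; first by rewrite mul1r.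
have -> : wshift a weps = 0 by [].
have -> : wtwist (par a) weps = weps.
  by apply/funext => -[|b v]; rewrite /wtwist /weps ?mulr0 // andbF mul1r.
by rewrite wmul0l add0r IH.
Qed.

Lemma weps_rel : wrel weps.
Proof.
move=> u v a b; have e0 z1 z z2 : weps (z1 ++ z :: z2) = 0 by case: z1.
by rewrite !e0 mulr0 subrr big1 // => k _; rewrite e0 mulr0.
Qed.

Variable phi : X -> F.
Hypothesis phi_rel : forall i, wrel (phi i).
Hypothesis phi0 : forall i, phi i [::] = 0.
Hypothesis phi1 : forall i b, phi i [:: b] = (i == b)%:R.

Definition wmonom (w : seq X) : F := foldr (fun i g => wmul (phi i) g) weps w.

Lemma wmonom_rel w : wrel (wmonom w).
Proof. by elim: w => [|i w IH]; [exact: weps_rel | exact: wrel_mul]. Qed.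

Lemma wmonom_cont w : word_cont (wmonom w) w.
Proof.
elim: w => [|i w IH]; first by case.
rewrite -cat1s; apply: word_cont_mul => // -[|b [|//]] _ vp //=.
by rewrite phi1; case: eqVneq vp => // ->; rewrite perm_refl.
Qed.

Variable ord : rel X.
Hypothesis ord_trans : transitive ord.
Hypothesis ord_anti : forall a b, ord a b -> ord b a -> a = b /\ ~~ par a.

(** The rule for differentiating a monomial, up to terms of higher order: [N] is the number of
    further occurrences of [i] in [w]. *)
Lemma wmonom_shift i w : path ord i w -> exists N : nat,
  word_ord (wshift i (wmonom (i :: w)) - N.+1%:R *: wmonom w) (size w).+1.
Proof.
have oP j : word_ord (phi j) 1 by case.
have o1 j : word_ord (wshift j (phi j) - weps) 1.
  by case=> // _; rewrite /wshift !fctE phi1 eqxx subrr.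
(* Shifting [phi j] by its own letter gives the unit [weps] plus terms of positive order, which are
   invisible on words this short. *)
have key j z v : (size v <= size z)%N ->
    wmul (wshift j (phi j)) (wmonom z) v = wmonom z v.
  move=> vz; apply/eqP; rewrite -subr_eq0 addrC -mulN1r -[X in _ * X]wmul_eps.
  rewrite -wmulDl scaleN1r addrC; apply/eqP.
  exact: (word_ord_mul (o1 j) (word_cont_ord (@wmonom_cont z))).
have shE j z v : wshift j (wmonom (j :: z)) v =
  wmul (wshift j (phi j)) (wmonom z) v +
  wmul (wtwist (par j) (phi j)) (wshift j (wmonom z)) v by [].
have difE j z k v : (wshift j (wmonom (j :: z)) - k *: wmonom z) v =
  wshift j (wmonom (j :: z)) v - k * wmonom z v by [].
elim: w i => [|j w IH] i.
  move=> _; exists 0%N => v vs; rewrite difE shE key // mul1r.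
  have -> : wshift i (wmonom [::]) = 0 by [].
  by rewrite wmul0r addr0 subrr.
rewrite [path _ _ _]/= => /andP[ij jw].
have [ijw|ijw] := boolP (i \in j :: w); last first.
  exists 0%N => v vs; rewrite difE shE key // mul1r addrAC subrr add0r.
  apply: (word_ord_mul (word_ord_twist (par i) (oP i))
    (word_cont_shiftN ijw (@wmonom_cont (j :: w)))).
  by rewrite add1n.
(* In a sorted word a second [i] must come next and be even, so the twist below is trivial. *)
have [ej pj] : i = j /\ ~~ par i.
  move: ijw; rewrite inE => /orP[/eqP e|iw].
    by move: ij; rewrite -e => ii; apply: ord_anti.
  apply: ord_anti => //; move: jw; rewrite (path_sortedE ord_trans).
  by move=> /andP[/allP/(_ _ iw)].
subst j; have [N HN] := IH _ jw; exists N.+1 => v vs.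
rewrite difE shE key //.
have -> : wtwist (par i) (phi i) = phi i.
  by apply/funext => z; rewrite /wtwist (negbTE pj) mul1r.
have := word_ord_mul (oP i) HN; rewrite add1n => /(_ v vs).
rewrite addrC -scaleNr wmulDr mulNr addrC => /eqP; rewrite subr_eq0 => /eqP ->.
have -> : wmul (phi i) (wmonom w) v = wmonom (i :: w) v by [].
by rewrite [N.+2%:R]mulrSr mulrDl mul1r addrC opprD; ring.
Qed.

(** The value is a product of positive integers, one for each derivative taken, and is nonzero in
    characteristic zero. *)
Lemma wmonom_diag w : sorted ord w -> wmonom w w != 0.
Proof.
elim: w => [|i w IH] iw; first by rewrite /= /weps eqxx oner_eq0.
have [N /(_ w (ltnSn _))] := wmonom_shift iw.
rewrite !fctE /wshift => /eqP; rewrite subr_eq0 => /eqP ->.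
by rewrite mulf_neq0 ?pnatr_eq0 ?IH //; exact: path_sorted iw.
Qed.

End WordFunctions.

(** * The enveloping algebra acts on compatible functions on words *)

Section WordModule.
Variables (K : numFieldType) (X : finType) (par : X -> bool).
Variable c : X -> X -> X -> K.
Local Notation F := (seq X -> K^o).

Definition wrel_pred : {pred F} := fun f => `[<wrel par c f>].

Fact wrel_submod : submod_closed wrel_pred.
Proof.
split=> [|k f g /asboolP ff /asboolP gg]; apply/asboolP => u v a b.
  by rewrite mulr0 subrr big1 // => i _; rewrite mulr0.
have E w : (k *: f + g) w = k * f w + g w by [].
rewrite !E mulrDr opprD addrACA gg mulrCA -mulrBr ff mulr_sumr -big_split /=.
by apply: eq_bigr => i _; rewrite E mulrDr mulrCA.
Qed.

HB.instance Definition _ := GRing.isSubmodClosed.Build K F wrel_pred wrel_submod.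

Definition wfun : Type := {f : F | f \in wrel_pred}.
HB.instance Definition _ := SubType.copy wfun {f : F | f \in wrel_pred}.
HB.instance Definition _ := gen_eqMixin wfun.
HB.instance Definition _ := gen_choiceMixin wfun.
HB.instance Definition _ := [SubChoice_isSubLmodule of wfun by <:].

Definition mk_wfun f (ff : wrel par c f) : wfun :=
  exist _ f (asboolT ff : f \in wrel_pred).

Lemma wfunP (f : wfun) : wrel par c (val f).
Proof. by apply/asboolP; exact: (valP f). Qed.

Fact weps_wfun_neq0 : mk_wfun (@weps_rel K X par c) != 0.
Proof.
apply/eqP => /(congr1 (fun f : wfun => val f [::])) /eqP.
by rewrite /= /weps eqxx oner_eq0.
Qed.

Local Notation A := (endo weps_wfun_neq0).

Definition wact_fun a (f : wfun) : wfun := mk_wfun (wrel_shift a (wfunP f)).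

Fact wact_linear a : linear (wact_fun a).
Proof. by move=> k f g; apply: val_inj. Qed.

Definition wact a : A := mk_endo _ (wact_linear a).

Lemma wact_rel a b :
  wact a * wact b - word_sign K par a b *: (wact b * wact a) =
  \sum_k c a b k *: wact k.
Proof.
apply: endo_eq => f; rewrite endoDE endoNE endoZE endo_sumE.
apply: val_inj; rewrite raddf_sum /=.
apply/funext => w; rewrite fct_sumE.
exact: (wfunP f [::] w a b).
Qed.

Lemma wact_prod v (f : wfun) w :
  val (endo_fun (\prod_(a <- v) wact a) f) w = val f (rev v ++ w).
Proof.
elim: v w => [|a v IH] w; first by rewrite big_nil.
by rewrite big_cons endoME rev_cons cat_rcons -IH.
Qed.

Section Enveloping.
Variables (U : algType K) (e : X -> U).
Hypothesis e_lift : forall (B : algType K) (g : X -> B),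
  (forall a b, g a * g b - word_sign K par a b *: (g b * g a) =
    \sum_k c a b k *: g k) ->
  exists f : {lrmorphism U -> B}, forall a, f (e a) = g a.

Definition word_prod v : U := \prod_(a <- v) e a.

(** The shifts satisfy the relations of the letters, so the universal property makes U act on
    compatible functions; acting on [f] and evaluating at the empty word gives the form. *)
Lemma wrel_functional (f : F) : wrel par c f ->
  exists L : U -> K, [/\ forall x y, L (x + y) = L x + L y,
    forall k x, L (k *: x) = k * L x & forall v, L (word_prod v) = f (rev v)].
Proof.
move=> ff; have [rho rhoE] := e_lift wact_rel.
exists (fun x => val (endo_fun (rho x) (mk_wfun ff)) [::]); split.
- by move=> x y; rewrite raddfD endoDE raddfD.
- by move=> k x; rewrite linearZ endoZE linearZ.
move=> v; rewrite /word_prod rmorph_prod.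
rewrite (eq_bigr wact) => [|a _]; last exact: rhoE.
by rewrite wact_prod cats0.
Qed.
End Enveloping.
End WordModule.

(** * Ordered monomials *)

Section PBW.
Variables (K : numFieldType) (X : finType) (par : X -> bool).
Variable c : X -> X -> X -> K.
Hypothesis c_par : forall a b k, c a b k != 0 -> par k = par a (+) par b.
Variables (U : algType K) (e : X -> U).
Local Notation ssign := (word_sign K par).
Local Notation wprod := (word_prod e).
Hypothesis e_rel : forall a b,
  e a * e b - ssign a b *: (e b * e a) = \sum_k c a b k *: e k.
Hypothesis e_lift : forall (B : algType K) (g : X -> B),
  (forall a b, g a * g b - ssign a b *: (g b * g a) = \sum_k c a b k *: g k) ->
  exists f : {lrmorphism U -> B}, forall a, f (e a) = g a.
Variable phi : X -> seq X -> K^o.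
Hypothesis phi_rel : forall i, wrel par c (phi i).
Hypothesis phi0 : forall i, phi i [::] = 0.
Hypothesis phi1 : forall i b, phi i [:: b] = (i == b)%:R.
Variable rk : X -> nat.
Hypothesis rk_inj : injective rk.
Implicit Types (l : seq (K * seq X)) (u v w : seq X) (a b k : X) (x : U).

(** Odd letters may not repeat, since the square of an odd letter is half its bracket with
    itself. *)
Definition okr a b := (rk a < rk b)%N || ((a == b) && ~~ par a).
Definition std w := sorted okr w.

Lemma okr_trans : transitive okr.
Proof.
move=> b a d /orP[ab|/andP[/eqP-> pa //]] /orP[bd|/andP[/eqP E pb]].
  by rewrite /okr (ltn_trans ab bd).
by rewrite -E /okr ab.
Qed.

Lemma okr_anti a b : okr a b -> okr b a -> a = b /\ ~~ par a.
Proof.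
move=> /orP[ab|/andP[/eqP-> pa] //] /orP[ba|/andP[/eqP E pb]].
  by have := ltn_trans ab ba; rewrite ltnn.
by rewrite E ltnn in ab.
Qed.

Lemma okr_antisym : antisymmetric okr.
Proof. by move=> a b /andP[/okr_anti ab /ab[]]. Qed.

Lemma okrN a b : ~~ okr a b -> (rk b < rk a)%N \/ (a = b /\ par a).
Proof.
rewrite /okr negb_or negb_and negbK -leqNgt leq_eqVlt => /andP[].
case/orP=> [/eqP/rk_inj ->|]; [rewrite eqxx /=; by right | by left].
Qed.

Lemma std_perm v w : std v -> std w -> perm_eq v w -> v = w.
Proof. exact: (sorted_eq okr_trans okr_antisym). Qed.

Lemma std_subseq v w : subseq v w -> std w -> std v.
Proof. exact: (subseq_sorted okr_trans). Qed.

Lemma std_rev w : sorted (fun a b => okr b a) (rev w) = std w.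
Proof. by rewrite rev_sorted. Qed.

Definition lin l : U := \sum_(p <- l) p.1 *: wprod p.2.
Definition lin_coef l w : K := \sum_(p <- l | p.2 == w) p.1.
Definition wspan (P : seq X -> Prop) x : Prop :=
  exists2 l, (forall p, p \in l -> P p.2) & x = lin l.

Lemma lin_coef_sum l (G : seq X -> K) :
  \sum_(p <- l) p.1 * G p.2 =
  \sum_(v <- undup [seq p.2 | p <- l]) lin_coef l v * G v.
Proof.
under [RHS]eq_bigr => v _ do rewrite /lin_coef mulr_suml big_mkcond.
rewrite exchange_big /= big_seq [RHS]big_seq; apply: eq_bigr => p pl.
rewrite (bigD1_seq p.2) ?undup_uniq ?mem_undup ?map_f //= eqxx.
by rewrite big1 ?addr0 // => v; rewrite eq_sym => /negbTE ->.
Qed.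

Lemma lin_coef_eq0 l w : (forall p, p \in l -> p.2 != w) -> lin_coef l w = 0.
Proof.
move=> lw; rewrite /lin_coef big_seq_cond big1 // => p /andP[/lw/negbTE->].
by [].
Qed.

(** Descending induction on the length of [w]. The form given by the monomial of [rev w] kills
    shorter words and words of the same length that do not rearrange [w], while the coefficients of
    longer words vanish by induction. A standard rearrangement of [w] is [w] itself, where the form
    is nonzero. *)
Theorem pbw_free l : (forall p, p \in l -> std p.2) -> lin l = 0 ->
  forall w, lin_coef l w = 0.
Proof.
move=> lstd l0; pose M := \max_(p <- l) size p.2.
suff H n w : (M < size w + n)%N -> lin_coef l w = 0.
  by move=> w; apply: (H M.+1); lia.
elim: n w => [|n IH] w Mw.
  apply: lin_coef_eq0 => p pl; apply: contraTneq Mw => <-.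
  by rewrite addn0 -leqNgt /M (big_rem p) //= leq_maxl.
have [ws|wns] := boolP (std w); last first.
  by apply: lin_coef_eq0 => p /lstd ps; apply: contraNneq wns => <-.
have [L [LD LZ Lw]] := wrel_functional e_lift
  (wmonom_rel c_par phi_rel (rev w)).
have L0 : L 0 = 0 by rewrite -(scale0r (0 : U)) LZ mul0r.
have : L (lin l) = 0 by rewrite l0.
have -> : L (lin l) = \sum_(p <- l) p.1 * wmonom par phi (rev w) (rev p.2).
  rewrite /lin; elim: (l) => [|p l' IHl]; first by rewrite !big_nil.
  by rewrite !big_cons LD LZ Lw IHl.
rewrite (lin_coef_sum l (fun v => wmonom par phi (rev w) (rev v))).
have rterm v : v \in [seq p.2 | p <- l] -> v != w ->
    lin_coef l v * wmonom par phi (rev w) (rev v) = 0.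
  move=> /mapP[p pl ->] pw.
  have [lt|ge] := ltnP (size w) (size p.2).
    by rewrite IH ?mul0r // (leq_trans Mw) // addnS -addSn leq_add2r.
  rewrite (wmonom_cont par phi0 phi1) ?mulr0 ?size_rev //.
  apply: contraNN pw; rewrite perm_rev perm_sym perm_rev perm_sym => pw.
  by apply/eqP; apply: std_perm => //; exact: lstd.
have [wl|wl] := boolP (w \in [seq p.2 | p <- l]); last first.
  move=> _; apply: lin_coef_eq0 => p pl; apply: contraNneq wl => <-.
  exact: map_f.
rewrite (bigD1_seq w) ?undup_uniq ?mem_undup //= big_seq_cond big1 ?addr0.
  move/eqP; rewrite mulf_eq0 => /orP[/eqP //|].
  rewrite (negbTE (wmonom_diag phi0 phi1 (par := par) (ord := fun a b => okr b a) _ _ _)) //.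
  - by move=> a b d ab bd; exact: okr_trans bd ab.
  - by move=> a b ab ba; apply: okr_anti.
  - by rewrite std_rev.
by move=> v /andP[]; rewrite mem_undup => vl vw; exact: rterm.
Qed.

Lemma lin_cat l l' : lin (l ++ l') = lin l + lin l'.
Proof. by rewrite /lin big_cat. Qed.

Lemma lin_coef_cat l l' w : lin_coef (l ++ l') w = lin_coef l w + lin_coef l' w.
Proof. by rewrite /lin_coef big_cat. Qed.

Definition lscale (z : K) l := [seq (z * p.1, p.2) | p <- l].

Lemma lin_scale z l : lin (lscale z l) = z *: lin l.
Proof.
rewrite /lin big_map scaler_sumr; apply: eq_bigr => p _ /=.
by rewrite scalerA.
Qed.

Lemma lin_coef_scale z l w : lin_coef (lscale z l) w = z * lin_coef l w.
Proof. by rewrite /lin_coef big_map mulr_sumr. Qed.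

Section Span.
Implicit Types P Q : seq X -> Prop.

Lemma wspanW P Q x : (forall v, P v -> Q v) -> wspan P x -> wspan Q x.
Proof. by move=> PQ [l lP ->]; exists l => // p /lP/PQ. Qed.

Lemma wspan0 P : wspan P 0.
Proof. by exists [::] => //; rewrite /lin big_nil. Qed.

Lemma wspanD P x y : wspan P x -> wspan P y -> wspan P (x + y).
Proof.
move=> [l lP ->] [l' lP' ->]; exists (l ++ l'); last by rewrite lin_cat.
by move=> p; rewrite mem_cat => /orP[/lP|/lP'].
Qed.

Lemma wspanZ P z x : wspan P x -> wspan P (z *: x).
Proof.
move=> [l lP ->]; exists (lscale z l); last by rewrite lin_scale.
by move=> p /mapP[q /lP ? ->].
Qed.

Lemma wspan_sum P (I : eqType) (r : seq I) (C : pred I) (f : I -> U) :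
  (forall i, i \in r -> C i -> wspan P (f i)) ->
  wspan P (\sum_(i <- r | C i) f i).
Proof.
move=> rP; rewrite big_seq_cond; elim/big_ind: _ => [|x y|i /andP[]].
- exact: wspan0.
- exact: wspanD.
- exact: rP.
Qed.

Lemma wspan_wprod P w : P w -> wspan P (wprod w).
Proof.
move=> Pw; exists [:: (1, w)]; first by move=> p; rewrite inE => /eqP ->.
by rewrite /lin big_seq1 scale1r.
Qed.

Lemma wprod_cat v w : wprod (v ++ w) = wprod v * wprod w.
Proof. by rewrite /word_prod big_cat. Qed.

Lemma wspanM P Q (T : seq X -> Prop) x y :
  (forall v w, P v -> Q w -> T (v ++ w)) ->
  wspan P x -> wspan Q y -> wspan T (x * y).
Proof.
move=> PQT [l lP ->] [l' lQ ->]; rewrite /lin mulr_suml.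
apply: wspan_sum => p pl _; rewrite mulr_sumr; apply: wspan_sum => q ql _.
rewrite -scalerAl -scalerAr -wprod_cat; do 2!apply: wspanZ.
by apply: wspan_wprod; apply: PQT; [exact: lP | exact: lQ].
Qed.
End Span.

Lemma wprod_swap u a b v : wprod (u ++ a :: b :: v) =
  ssign a b *: wprod (u ++ b :: a :: v) + \sum_k c a b k *: wprod (u ++ k :: v).
Proof.
have E z : wprod (u ++ z ++ v) = wprod u * wprod z * wprod v.
  by rewrite !wprod_cat mulrA.
have := E [:: a; b]; have := E [:: b; a]; rewrite /= => -> ->.
under eq_bigr => k _ do rewrite (E [:: k]) /word_prod big_seq1
  scalerAl scalerAr.
rewrite -mulr_suml -mulr_sumr -e_rel scalerAl scalerAr -mulrDl -mulrDr.
by rewrite /word_prod !big_cons big_nil !mulr1 addrC subrK.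
Qed.

(** Ranks weighted by the distance from the end, so that transposing a descent lowers the value. *)
Fixpoint wmeas w : nat :=
  if w is a :: w' then (rk a * (size w').+1 + wmeas w')%N else 0%N.

Lemma wmeas_swap u a b v : (rk b < rk a)%N ->
  (wmeas (u ++ b :: a :: v) < wmeas (u ++ a :: b :: v))%N.
Proof.
move=> ba; elim: u => [|d u IH] /=; first by nia.
by rewrite !size_cat /= ltn_add2l.
Qed.

Lemma std_split w : ~~ std w ->
  exists u a b v, w = u ++ a :: b :: v /\ ~~ okr a b.
Proof.
elim: w => [//|a [//|b w] IH] /=; rewrite negb_and => /orP[ab|bw].
  by exists [::], a, b, w.
have [u [a' [b' [v [-> ab]]]]] := IH bw.
by exists (a :: u), a', b', v.
Qed.

(* Sorting by transpositions, a word is a combination of standard words;      *)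
(* [P] records whatever survives transpositions and brackets of neighbours.   *)
Lemma straighten (P : seq X -> Prop) :
  (forall u a b v, P (u ++ a :: b :: v) -> P (u ++ b :: a :: v)) ->
  (forall u a b k v, c a b k != 0 -> P (u ++ a :: b :: v) -> P (u ++ k :: v)) ->
  forall w, P w -> wspan (fun v => std v /\ P v) (wprod w).
Proof.
move=> Pswap Pbr w; have [n] := ubnP (size w); elim: n w => // n IHn w.
have [m] := ubnP (wmeas w); elim: m w => // m IHm w wm wn Pw.
have [ws|/std_split[u [a [b [v [E ab]]]]]] := boolP (std w).
  exact: wspan_wprod.
rewrite {w}E in wm wn Pw *.
have bracket : wspan (fun v => std v /\ P v)
    (\sum_k c a b k *: wprod (u ++ k :: v)).
  apply: wspan_sum => k _ _; have [->|c0] := eqVneq (c a b k) 0.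
    by rewrite scale0r; exact: wspan0.
  apply: wspanZ; apply: IHn; last exact: Pbr Pw.
  by move: wn; rewrite !size_cat /= !addnS.
have [ba|[E pa]] := okrN ab.
  rewrite wprod_swap; apply: wspanD => //; apply: wspanZ; apply: IHm.
  - by apply: leq_trans (wmeas_swap _ _ ba) _; rewrite -ltnS.
  - by move: wn; rewrite !size_cat.
  - exact: Pswap.
(* A repeated odd letter is not transposed but replaced by half its bracket with itself. *)
subst b; have -> : wprod (u ++ [:: a, a & v]) =
    2^-1 *: \sum_k c a a k *: wprod (u ++ k :: v).
  have := wprod_swap u a a v; rewrite /word_sign pa scaleN1r.
  move=> /(congr1 (fun z => wprod (u ++ [:: a, a & v]) + z)).
  rewrite addrA subrr add0r -mulr2n -scaler_nat => <-.
  by rewrite scalerA mulVf ?pnatr_eq0 ?scale1r.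
exact: wspanZ.
Qed.

(** * Coordinates with respect to standard words *)

Definition wcoef x : seq X -> K :=
  if pselect (wspan std x) is left H then lin_coef (projT1 (cid2 H))
  else fun=> 0.

(** Two expansions of one element differ by a relation between standard words, which [pbw_free]
    makes trivial. *)
Lemma wcoef_lin l : (forall p, p \in l -> std p.2) ->
  wcoef (lin l) = lin_coef l.
Proof.
move=> ls; rewrite /wcoef; case: pselect => [H|[]]; last by exists l.
case: (cid2 H) => l' /= ls' E; apply/funext => w; apply/eqP.
rewrite -subr_eq0 -mulN1r -lin_coef_scale -lin_coef_cat; apply/eqP.
apply: pbw_free; last by rewrite lin_cat lin_scale scaleN1r -E subrr.
by move=> p; rewrite mem_cat => /orP[/ls' //|/mapP[q /ls ? ->]].
Qed.

Lemma wcoefD x y w : wspan std x -> wspan std y ->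
  wcoef (x + y) w = wcoef x w + wcoef y w.
Proof.
move=> [l ls ->] [l' ls' ->].
rewrite -lin_cat !wcoef_lin ?lin_coef_cat // => p.
by rewrite mem_cat => /orP[/ls|/ls'].
Qed.

Lemma wcoefZ z x w : wspan std x -> wcoef (z *: x) w = z * wcoef x w.
Proof.
move=> [l ls ->]; rewrite -lin_scale !wcoef_lin ?lin_coef_scale // => p.
by move=> /mapP[q /ls ? ->].
Qed.

Lemma wcoef0 w : wcoef 0 w = 0.
Proof. by rewrite -(scale0r (0 : U)) wcoefZ ?mul0r //; exact: wspan0. Qed.

Lemma wcoef_sum (I : eqType) (r : seq I) (C : pred I) (f : I -> U) w :
  (forall i, i \in r -> C i -> wspan std (f i)) ->
  wcoef (\sum_(i <- r | C i) f i) w = \sum_(i <- r | C i) wcoef (f i) w.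
Proof.
move=> fs; rewrite big_seq_cond [RHS]big_seq_cond.
suff [] : wspan std (\sum_(i <- r | (i \in r) && C i) f i) /\
  wcoef (\sum_(i <- r | (i \in r) && C i) f i) w =
    \sum_(i <- r | (i \in r) && C i) wcoef (f i) w by [].
elim/big_rec2: _ => [|i y x /andP[ir Ci] [xs E]].
  by split; [exact: wspan0 | exact: wcoef0].
split; first by apply: wspanD => //; exact: fs.
by rewrite wcoefD ?E //; exact: fs.
Qed.

Lemma wcoef_wprod w v : std w -> wcoef (wprod w) v = (w == v)%:R.
Proof.
move=> ws; have -> : wprod w = lin [:: (1, w)].
  by rewrite /lin big_seq1 scale1r.
rewrite wcoef_lin => [|p]; last by rewrite inE => /eqP ->.
by rewrite /lin_coef big_mkcond big_seq1 /=; case: eqP.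
Qed.

Lemma wcoef_span (P : seq X -> Prop) x w : (forall v, P v -> std v) ->
  wspan P x -> wcoef x w != 0 -> P w.
Proof.
move=> Ps [l lP ->]; rewrite wcoef_lin => [|p /lP/Ps //] lw.
apply: contrapT => Pw; move/eqP: lw; apply; apply: lin_coef_eq0 => p pl.
by apply: contra_notN Pw => /eqP <-; exact: lP.
Qed.

Lemma wcoef_inj x : wspan std x -> (forall w, wcoef x w = 0) -> x = 0.
Proof.
move=> [l ls ->] l0; rewrite wcoef_lin // in l0.
elim: {l}(size l) {-2}l (leqnn (size l)) ls l0 => [|n IH] l ln ls l0.
  by case: l ln ls l0 => //; rewrite /lin big_nil.
case: l ln ls l0 => [|[z w] l] ln ls l0; first by rewrite /lin big_nil.
pose l1 := [seq p <- (z, w) :: l | p.2 == w].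
pose l2 := [seq p <- (z, w) :: l | p.2 != w].
have E : lin ((z, w) :: l) = lin l1 + lin l2.
  by rewrite /lin !big_filter (bigID (fun p => p.2 == w)).
have E1 : lin l1 = 0.
  rewrite /lin big_filter (eq_bigr (fun p => p.1 *: wprod w)) => [|p /eqP -> //].
  by rewrite -scaler_suml; have := l0 w; rewrite /lin_coef => ->; rewrite scale0r.
rewrite E E1 add0r; apply: IH.
- by rewrite /l2 /= eqxx /= size_filter (leq_trans (count_size _ _)).
- by move=> p; rewrite mem_filter => /andP[_ /ls].
move=> v; rewrite /lin_coef big_filter_cond.
have [->|vw] := eqVneq v w.
  by rewrite big1 // => p /andP[/negbTE ->].
rewrite -[RHS](l0 v) /lin_coef; apply: eq_bigl => p.
by case: (eqVneq p.2 w) => [->|//]; rewrite eq_sym (negbTE vw).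
Qed.

Lemma lin_regroup l :
  lin l = \sum_(v <- undup [seq p.2 | p <- l]) lin_coef l v *: wprod v.
Proof.
under [RHS]eq_bigr => v _ do rewrite /lin_coef scaler_suml big_mkcond.
rewrite exchange_big /= /lin big_seq [RHS]big_seq; apply: eq_bigr => p pl.
rewrite (bigD1_seq p.2) ?undup_uniq ?mem_undup ?map_f //= eqxx.
by rewrite big1 ?addr0 // => v; rewrite eq_sym => /negbTE ->.
Qed.

Lemma wspan_coef (P : seq X -> Prop) x : (forall v, P v -> std v) ->
  wspan P x -> wspan (fun w => P w /\ wcoef x w != 0) x.
Proof.
move=> Ps [l lP ->]; have cE := wcoef_lin (fun p pl => Ps _ (lP p pl)).
rewrite {2}lin_regroup; apply: wspan_sum => v; rewrite mem_undup.
case/mapP => p pl -> _; have [->|c0] := eqVneq (lin_coef l p.2) 0.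
  by rewrite scale0r; exact: wspan0.
by apply: wspanZ; apply: wspan_wprod; rewrite cE; split=> //; exact: lP.
Qed.

Lemma wprod_span v : wspan (fun w => std w /\ (size w < size v \/ perm_eq w v)%N)
  (wprod v).
Proof.
apply: straighten => [u a b w|u a b k w _|]; last by right.
- case=> [lt|p]; first by left; move: lt; rewrite !size_cat.
  right; rewrite -(permPr p) perm_cat2l -[_ :: _ :: w]/([:: b] ++ [:: a] ++ w).
  by rewrite perm_catCA.
- move=> H; left; have : (size (u ++ [:: a, b & w]) <= size v)%N.
    by case: H => [/ltnW //|/perm_size ->].
  by rewrite !size_cat /= => H1; lia.
Qed.

Lemma wprod_std v : wspan std (wprod v).
Proof. by apply: wspanW (wprod_span v) => w []. Qed.

Lemma wcoef_wprod_size v w : wcoef (wprod v) w != 0 ->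
  (size w < size v)%N \/ perm_eq w v.
Proof. by move/(wcoef_span (fun _ => @proj1 _ _) (wprod_span v)) => []. Qed.

Lemma wcoef_wprod_lt v w : (size v < size w)%N -> wcoef (wprod v) w = 0.
Proof.
move=> vw; apply/eqP/negPn/negP => /wcoef_wprod_size[H|/perm_size H].
  by have := ltn_trans vw H; rewrite ltnn.
by rewrite H ltnn in vw.
Qed.

(** Letters supercommute in top degree: the brackets yield shorter words, which cannot reach [w]. *)
Lemma wcoef_wprod_swap u a b v w : (size (u ++ a :: b :: v) <= size w)%N ->
  wcoef (wprod (u ++ a :: b :: v)) w =
  ssign a b * wcoef (wprod (u ++ b :: a :: v)) w.
Proof.
move=> sw; rewrite wprod_swap wcoefD.
- rewrite wcoefZ ?wcoef_sum; first last.
  + exact: wprod_std.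
  + by move=> k _ _; apply: wspanZ; exact: wprod_std.
  rewrite big1 ?addr0 // => k _; rewrite wcoefZ; last exact: wprod_std.
  rewrite wcoef_wprod_lt ?mulr0 //; move: sw; rewrite !size_cat /= => sw; lia.
- by apply: wspanZ; exact: wprod_std.
- by apply: wspan_sum => k _ _; apply: wspanZ; exact: wprod_std.
Qed.

Lemma wcoef_wprod_perm v w : std w -> perm_eq v w -> wcoef (wprod v) w != 0.
Proof.
move=> ws; have [m] := ubnP (wmeas v); elim: m v => // m IH v vm vw.
have [vs|/std_split[u [a [b [v' [E ab]]]]]] := boolP (std v).
  by rewrite wcoef_wprod // (std_perm vs ws vw) eqxx oner_eq0.
rewrite {v}E in vm vw *.
have [ba|[E pa]] := okrN ab.
  rewrite wcoef_wprod_swap ?(perm_size vw) // mulf_neq0 ?signr_eq0 //.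
  apply: IH; first by apply: leq_trans (wmeas_swap _ _ ba) _; rewrite -ltnS.
  rewrite -(permPr vw) perm_cat2l -[_ :: _ :: v']/([:: b] ++ [:: a] ++ v').
  by rewrite perm_catCA.
(* Two adjacent equal odd letters are impossible: [v] rearranges the standard word [w], which holds
   an odd letter at most once. *)
have : (count_mem a w <= 1)%N.
  elim: (w) ws => [//|d w' IHw] dw /=.
  have := IHw (path_sorted dw); case: eqVneq => [ad|//] _.
  suff /count_memPn -> : a \notin w' by [].
  apply/negP => aw; move: dw; rewrite /std /= (path_sortedE okr_trans).
  move=> /andP[/allP/(_ _ aw)]; rewrite ad /okr ltnn pa andbF //.
by rewrite -(permP vw) count_cat /= -E eqxx; lia.
Qed.

Lemma wcoef_wprod_even u a v w : ~~ par a -> (size (u ++ a :: v) <= size w)%N ->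
  wcoef (wprod (u ++ a :: v)) w = wcoef (wprod (a :: u ++ v)) w.
Proof.
move=> pa; elim/last_ind: u v => [//|u b IH] v sw.
rewrite cat_rcons in sw; rewrite !cat_rcons wcoef_wprod_swap //.
rewrite /word_sign (negbTE pa) andbF mul1r IH ?cat_rcons //.
by move: sw; rewrite !size_cat.
Qed.

Definition adw a (p : bool) x : U := e a * x - (-1) ^+ (par a && p) *: (x * e a).

(** The super Leibniz rule; the sign records the odd letters already crossed by [a]. *)
Lemma adw_wprod a w : adw a (wpar par w) (wprod w) =
  \sum_(i < size w) (-1) ^+ (par a && wpar par (take i w)) *:
    \sum_k c a (nth a w i) k *: wprod (take i w ++ k :: drop i.+1 w).
Proof.
rewrite /adw; elim: w => [|b w IH].
  by rewrite big_ord0 /word_prod big_nil mulr1 mul1r andbF scale1r subrr.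
rewrite big_ord_recl /= andbF scale1r drop0.
have cons k z : wprod (k :: z) = e k * wprod z by rewrite /word_prod big_cons.
under eq_bigr => k _ do rewrite cons scalerAl.
rewrite -mulr_suml -e_rel cons.
have -> : \sum_(i < size w) (-1) ^+ (par a && wpar par (b :: take i w)) *:
    (\sum_k c a (nth a w i) k *: wprod (b :: take i w ++ k :: drop i.+1 w)) =
    ssign a b *: (e b * \sum_(i < size w)
      (-1) ^+ (par a && wpar par (take i w)) *:
    \sum_k c a (nth a w i) k *: wprod (take i w ++ k :: drop i.+1 w)).
  rewrite mulr_sumr scaler_sumr; apply: eq_bigr => i _.
  rewrite -scalerAr scalerA -signr_addb mulr_sumr; congr (_ ^+ _ *: _).
    by rewrite /wpar /= oddD oddb; case: (par a) (par b) (odd _) => [] [] [].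
  by apply: eq_bigr => k _; rewrite cons scalerAr.
rewrite -IH mulrBl mulrBr scalerBr -!scalerAl -!scalerAr !mulrA scalerA.
rewrite -signr_addb addrA subrK; congr (_ - _ ^+ _ *: _).
by rewrite /wpar /= oddD oddb; case: (par a) (par b) (odd _) => [] [] [].
Qed.


Lemma wcoef_adw a v w : wcoef (adw a (wpar par v) (wprod v)) w =
  \sum_(i < size v) (-1) ^+ (par a && wpar par (take i v)) *
    \sum_k c a (nth a v i) k * wcoef (wprod (take i v ++ k :: drop i.+1 v)) w.
Proof.
have ks i : wspan std
    (\sum_k c a (nth a v i) k *: wprod (take i v ++ k :: drop i.+1 v)).
  by apply: wspan_sum => k _ _; apply: wspanZ; exact: wprod_std.
rewrite adw_wprod wcoef_sum => [|i _ _]; last exact: wspanZ.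
apply: eq_bigr => i _; rewrite wcoefZ // wcoef_sum => [|k _ _].
  by congr (_ * _); apply: eq_bigr => k _; rewrite wcoefZ //; exact: wprod_std.
by apply: wspanZ; exact: wprod_std.
Qed.

(** * Roots, heights and the leading word of a bracket *)

Section Graded.
Variables (N : nat) (lr lc : X -> nat).
Implicit Types (y : X) (i j : nat).
Hypothesis letter_inj : forall a b,
  par a = par b -> lr a = lr b -> lc a = lc b -> a = b.
Hypothesis lr_lt : forall a, (lr a < N)%N.

(* The coefficient of the [j]-th simple root in the root of [a].              *)
Definition lwt j a : int := (lr a <= j)%N%:Z - (lc a <= j)%N%:Z.
Hypothesis c_wt : forall a b k, c a b k != 0 ->
  forall j, lwt j k = lwt j a + lwt j b.

Definition upper a := (lr a < lc a)%N.
Definition lower a := (lc a < lr a)%N.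
Hypothesis rk_upper : forall a b, ~~ upper a -> upper b -> (rk a < rk b)%N.

Lemma lwtE j a : lwt j a =
  (upper a && (lr a <= j < lc a)%N)%:Z - (lower a && (lc a <= j < lr a)%N)%:Z.
Proof.
rewrite /lwt /upper /lower; case: (ltngtP (lr a) (lc a)) => [l|l|->] /=;
  rewrite ?subrr //; case: (leqP (lr a) j) => h; case: (leqP (lc a) j) => h' //=; lia.
Qed.

Lemma nat_interval_inj p q r s : (p < q)%N -> (r < s)%N ->
  (forall j, (p <= j < q)%N = (r <= j < s)%N) -> p = r /\ q = s.
Proof.
move=> pq rs E; move: (E p) (E r) (E q.-1) (E s.-1) => *.
by split; lia.
Qed.

Lemma upper_lower a : upper a -> lower a = false.
Proof. by rewrite /upper /lower ltnNge => /negbTE; case: ltngtP. Qed.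

Lemma lwt_gt0 j a : 0 < lwt j a -> upper a.
Proof. by rewrite lwtE; case: upper => //=; case: (_ && _). Qed.

Lemma lwt_lt0 j a : lwt j a < 0 -> lower a.
Proof. by rewrite lwtE; case: lower => //=; case: (_ && _). Qed.

Lemma lwt_upper j a : upper a -> lwt j a = (lr a <= j < lc a)%N%:Z.
Proof. by move=> ua; rewrite lwtE ua upper_lower // subr0. Qed.

Lemma lwt_lr a : upper a -> lwt (lr a) a = 1.
Proof. by move=> ua; rewrite lwt_upper // leqnn [_ && _]ua. Qed.

Lemma lwt_le0 j a : ~~ upper a -> lwt j a <= 0.
Proof. by move=> ua; rewrite leNgt; apply: contra ua; exact: lwt_gt0. Qed.

Lemma lwt_ge0 j a : ~~ lower a -> 0 <= lwt j a.
Proof. by move=> ua; rewrite leNgt; apply: contra ua; exact: lwt_lt0. Qed.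

Lemma bracket_nonupper a b k :
  c a b k != 0 -> ~~ upper a -> ~~ upper b -> ~~ upper k.
Proof.
move=> c0 ua ub; apply/negP => uk; have := c_wt c0 (lr k).
by have := lwt_le0 (lr k) ua; have := lwt_le0 (lr k) ub; rewrite lwt_lr //; lia.
Qed.

Lemma upper_notlower a : upper a -> ~~ lower a.
Proof. by move/upper_lower ->. Qed.

Lemma bracket_upper a b k :
  c a b k != 0 -> upper a -> ~~ lower b -> upper k.
Proof.
move=> c0 ua lb; apply: (@lwt_gt0 (lr a)); rewrite (c_wt c0) lwt_lr //.
by have := lwt_ge0 (lr a) lb; lia.
Qed.

(** Only upper letters count: for a standard word this is the index nu of its summand J'(nu), not
    its full weight. *)
Definition wnu w j : nat := \sum_(a <- w) (upper a && (lr a <= j < lc a)%N).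
Definition wheight w : nat := \sum_(j < N) wnu w j.

Lemma wnu_cat u v j : wnu (u ++ v) j = (wnu u j + wnu v j)%N.
Proof. by rewrite /wnu big_cat. Qed.

Lemma wnu_cons a v j :
  wnu (a :: v) j = ((upper a && (lr a <= j < lc a)%N) + wnu v j)%N.
Proof. by rewrite /wnu big_cons. Qed.

Lemma wnu_perm u v j : perm_eq u v -> wnu u j = wnu v j.
Proof. exact: perm_big. Qed.

Lemma wheight_perm u v : perm_eq u v -> wheight u = wheight v.
Proof. by move=> uv; apply: eq_bigr => j _; exact: wnu_perm. Qed.

Lemma wheight_cat u v : wheight (u ++ v) = (wheight u + wheight v)%N.
Proof.
by rewrite /wheight -big_split /=; apply: eq_bigr => j _; rewrite wnu_cat.
Qed.

Lemma wnu_nonupper w j : all (predC upper) w -> wnu w j = 0%N.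
Proof.
move=> /allP wl; rewrite /wnu big_seq big1 // => a /wl /= /negbTE -> //.
Qed.

Lemma wheight_nonupper w : all (predC upper) w -> wheight w = 0%N.
Proof. by move=> wl; rewrite /wheight big1 // => j _; exact: wnu_nonupper. Qed.

Lemma wheight_upper1 a : upper a -> (0 < wheight [:: a])%N.
Proof.
move=> ua; rewrite /wheight (bigD1 (Ordinal (lr_lt a))) //=.
by rewrite wnu_cons ua leqnn [true && _]ua.
Qed.

Lemma straighten_nonupper w : all (predC upper) w ->
  wspan (fun v => std v /\ all (predC upper) v) (wprod w).
Proof.
apply: straighten => [u a b v|u a b k v c0]; rewrite !all_cat /=.
  by rewrite (andbCA (~~ upper a)).
move=> /andP[-> /and3P[ua ub ->]].
by rewrite (bracket_nonupper c0).
Qed.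

Lemma straighten_upper w : all upper w ->
  wspan (fun v => std v /\ (all upper v /\ forall j, wnu v j = wnu w j)) (wprod w).
Proof.
move=> wu; apply: straighten => [u a b v [uv E]|u a b k v c0 [uv E]|//].
  split; first by move: uv; rewrite !all_cat /= (andbCA (upper a)).
  move=> j; rewrite -E !wnu_cat !wnu_cons; congr (_ + _)%N.
  by rewrite addnCA.
move: uv; rewrite !all_cat /= => /andP[uu /and3P[ua ub uv]].
have uk := bracket_upper c0 ua (upper_notlower ub).
rewrite uu uv uk; split=> // j; rewrite -E !wnu_cat !wnu_cons; congr (_ + _)%N.
rewrite addnA; congr (_ + _)%N; apply/eqP; rewrite -eqz_nat PoszD.
by rewrite ua ub uk /= -!lwt_upper // (c_wt c0).
Qed.

Lemma std_cat u v : std u -> std v ->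
  all (predC upper) u -> all upper v -> std (u ++ v).
Proof.
rewrite /std !(sorted_pairwise okr_trans) pairwise_cat => -> -> /= ul vu.
rewrite !andbT; apply/allrelP => a b au bv.
by rewrite /okr rk_upper //; [exact: (allP ul) | exact: (allP vu)].
Qed.

(** The factorization of U(g) as U(b^-) U(n^+), read off from upper letters having the greatest
    ranks. *)
Lemma std_nonupper_upper w : std w -> exists u v,
  [/\ w = u ++ v, std u, std v, all (predC upper) u & all upper v].
Proof.
elim: w => [|a w IH] aw; first by exists [::], [::].
have [ua|ua] := boolP (upper a).
  exists [::], (a :: w); split=> //=; rewrite ua /=; apply/allP => b bw.
  move: aw; rewrite /std /= (path_sortedE okr_trans) => /andP[/allP/(_ b bw) + _].
  apply: contraTT => ub; rewrite /okr negb_or -leqNgt ltnW ?rk_upper //=.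
  by apply/negP => /andP[/eqP ab]; rewrite ab (negbTE ub) in ua.
have [u [v [E su sv ul vu]]] := IH (path_sorted aw).
have sau : std (a :: u).
  by apply: (std_subseq _ aw); rewrite E /= eqxx prefix_subseq.
by exists (a :: u), v; split=> //=; [rewrite E | rewrite ua].
Qed.

(** Once [u] is standard, its upper part joins [q]; the two sides then straighten separately within
    b^- and n^+, the latter preserving weight. *)
Lemma wprod_ge_height u q : all upper q ->
  wspan (fun v => std v /\ (wheight q <= wheight v)%N) (wprod (u ++ q)).
Proof.
move=> qu; rewrite wprod_cat; have [l ls ->] := wprod_std u.
rewrite /lin mulr_suml; apply: wspan_sum => p /ls ps _.
rewrite -scalerAl; apply: wspanZ.
have [b [q' [-> sb _ bl qu']]] := std_nonupper_upper ps.
rewrite wprod_cat -mulrA -wprod_cat.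
have qq : all upper (q' ++ q) by rewrite all_cat qu' qu.
apply: (wspanM _ (straighten_nonupper bl) (straighten_upper qq)).
move=> v w [sv vl] [sw [wu E]]; split; first exact: std_cat.
rewrite wheight_cat (_ : wheight w = wheight (q' ++ q)).
  by rewrite wheight_cat; lia.
by apply: eq_bigr => j _; rewrite E.
Qed.

(** Multiplication on the left changes only what stands before the n^+ part, and on the right it
    lengthens that part. *)
Lemma adw_ge_height a w p : upper a -> std w ->
  wspan (fun v => std v /\ (wheight w <= wheight v)%N) (adw a p (wprod w)).
Proof.
move=> ua /std_nonupper_upper[b [q [-> _ _ bl qu]]].
rewrite /adw -scaleNr wheight_cat (wheight_nonupper bl) add0n.
have e1 : e a = wprod [:: a] by rewrite /word_prod big_seq1.
apply: wspanD; first by rewrite e1 -wprod_cat catA; exact: wprod_ge_height.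
apply: wspanZ; rewrite e1 -wprod_cat -catA.
apply: wspanW (wprod_ge_height b (q := q ++ [:: a]) _); last first.
  by rewrite all_cat qu /= ua.
by move=> v []; rewrite wheight_cat => sv hv; split=> //; lia.
Qed.

Lemma std_odd_nth w y i j : std w -> par y ->
  (i < size w)%N -> (j < size w)%N -> nth y w i = y -> nth y w j = y -> i = j.
Proof.
move=> sw py; wlog ij : i j / (i < j)%N.
  move=> H iw jw iy jy; case: (ltngtP i j) => // ij; first exact: H.
  by apply/esym; apply: H.
move=> iw jw iy jy; have := sorted_ltn_nth okr_trans y sw i j iw jw ij.
by rewrite iy jy /okr ltnn py andbF.
Qed.

Lemma std_insert w h : ~~ par h -> std w ->
  exists2 v, std v & perm_eq v (h :: w).
Proof.
move=> ph sw; pose L := [seq a <- w | okr a h]; pose R := [seq a <- w | ~~ okr a h].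
exists (L ++ h :: R); last by rewrite -cat1s perm_catCA /= perm_cons perm_filterC.
have Rh a : a \in R -> okr h a.
  rewrite mem_filter => /andP[/okrN[ha _|[-> pa]]]; first by rewrite /okr ha.
  by rewrite pa in ph.
rewrite /std (sorted_pairwise okr_trans) pairwise_cat /=.
rewrite -!(sorted_pairwise okr_trans) !(sorted_filter okr_trans) //= andbT.
apply/andP; split; last by apply/allP.
apply/allrelP => a b; rewrite mem_filter => /andP[ah _].
by rewrite inE => /orP[/eqP -> //|/Rh]; exact: okr_trans ah.
Qed.

(** Lower letters outweigh odd diagonal ones, these outweigh even diagonal ones (whose rows are
    below [N]), and distinct even diagonal letters get distinct values. *)
Definition wstat w : nat :=
  \sum_(a <- w) (if lower a then N.+1 else if upper a then 0
                 else if par a then N else lr a)%N.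

Lemma wstat_perm u v : perm_eq u v -> wstat u = wstat v.
Proof. exact: perm_big. Qed.

Lemma take_drop_perm (x0 : X) w i k : (i < size w)%N ->
  perm_eq (nth x0 w i :: take i w ++ k :: drop i.+1 w) (k :: w).
Proof.
move=> iw; rewrite -[X in perm_eq _ (k :: X)](cat_take_drop i w).
rewrite (drop_nth x0 iw) -[nth _ _ _ :: drop _ _]cat1s.
rewrite -[X in perm_eq X _]/([:: nth x0 w i] ++ (take i w ++ ([:: k] ++ drop i.+1 w))).
rewrite -[X in perm_eq _ X]/([:: k] ++ (take i w ++ ([:: nth x0 w i] ++ drop i.+1 w))).
by rewrite perm_catCA perm_sym perm_catCA perm_cat2l perm_catCA.
Qed.

(* Replacing one lower letter [y] by the diagonal letter [h] that occurs      *)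
(* first in the bracket of [y] with the opposite letter [a] is the move that  *)
(* lowers [wstat] most; hence only [w] itself reaches [w'] among the words of *)
(* the same size and height whose [wstat] is at least that of [w].            *)
Lemma adw_leading w w' v a y h :
  std w -> std w' -> std v -> y \in w -> upper a -> lower y ->
  lr a = lc y -> lc a = lr y -> par a = par y -> c a y h != 0 ->
  (forall k, c a y k != 0 -> (lr h <= lr k)%N) ->
  perm_eq w' (h :: rem y w) ->
  size v = size w -> wheight v = wheight w -> (wstat w <= wstat v)%N ->
  (wcoef (adw a (wpar par v) (wprod v)) w' != 0) = (v == w).
Proof.
move=> sw sw' sv yw ua ly ar ac pay ch hmin pw' szv hv stv.
have nly : upper y = false.
  by apply: contraTF ly => uy; rewrite (upper_lower uy).
have diag k : c a y k != 0 -> [/\ lr k = lc k, ~~ par k, upper k = false & lower k = false].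
  move=> ck; have wk j : lwt j k = 0.
    rewrite (c_wt ck) lwt_upper // lwtE nly ly /= ar ac.
    by rewrite sub0r subrr.
  have uk : upper k = false by apply: contraTF isT => uk; have := wk (lr k); rewrite lwt_lr.
  have lk : lower k = false.
    apply: contraTF isT => lk; have := wk (lc k).
    by rewrite lwtE uk lk leqnn /= -/(lower k) lk.
  split=> //; last by rewrite (c_par ck) pay addbb.
  by move: uk lk; rewrite /upper /lower; case: ltngtP.
have [hd ph hnu hnl] := diag h ch.
have szw' : size w' = size w.
  by rewrite (perm_size pw') /= (perm_size (perm_to_rem yw)).
have stw' : (wstat w' + N.+1 = wstat w + lr h)%N.
  rewrite (wstat_perm pw') (wstat_perm (perm_to_rem yw)) /wstat !big_cons.
  rewrite hnl hnu (negbTE ph) ly.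
  by rewrite addnC addnA addnAC.
have hw' : wheight w' = wheight w.
  rewrite (wheight_perm pw') (wheight_perm (perm_to_rem yw)).
  by apply: eq_bigr => j _; rewrite !wnu_cons hnu nly.
have term i k : (i < size v)%N -> c a (nth a v i) k != 0 ->
    wcoef (wprod (take i v ++ k :: drop i.+1 v)) w' != 0 ->
    [/\ nth a v i = y, k = h & v = w].
  move=> iv ck /wcoef_wprod_size Hs.
  have tdp := take_drop_perm a k iv.
  have szt : size (take i v ++ k :: drop i.+1 v) = size w'.
    by have /= [] := perm_size tdp; rewrite szw' -szv.
  have pt : perm_eq w' (take i v ++ k :: drop i.+1 v).
    by case: Hs => //; rewrite szt ltnn.
  have pv : perm_eq (nth a v i :: w') (k :: v).
    by apply: perm_trans tdp; rewrite perm_cons.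
  set y' := nth a v i in ck pv *.
  have hE : (wheight [:: y'] + wheight w' = wheight [:: k] + wheight v)%N.
    by rewrite -!wheight_cat; exact: wheight_perm.
  have hE' : wheight [:: y'] = wheight [:: k] by move: hE; rewrite hw' hv => /addIn.
  (* The bracket of [a] with a letter that is not lower is upper and of greater height than that
     letter, against [hE']. *)
  have ly' : lower y'.
    apply: contraT => nl; have uk := bracket_upper ck ua nl.
    have [uy|uy] := boolP (upper y').
      have : (wheight [:: k] = wheight [:: a] + wheight [:: y'])%N.
        rewrite /wheight -big_split; apply: eq_bigr => j _; rewrite /= !wnu_cons.
        rewrite ![wnu [::] _]big_nil !addn0 ua uk uy /=.
        apply/eqP; rewrite -eqz_nat PoszD -!lwt_upper //; exact/eqP/c_wt.
      rewrite hE' -{1}[wheight [:: k]]add0n => /addIn E.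
      by have := wheight_upper1 ua; rewrite -E.
    have := wheight_upper1 uk; rewrite -hE' wheight_nonupper //=.
    by rewrite uy.
  have uk : upper k = false.
    apply/negP => uk; have := wheight_upper1 uk; rewrite -hE' wheight_nonupper //=.
    by rewrite andbT; apply: contraL ly' => uy; rewrite upper_lower.
  have := wstat_perm pv; rewrite /wstat !big_cons -!/(wstat _) ly' uk => stE.
  (* [v] has at least the statistic of [w] and loses a lower letter as [w] does, so the new letter
     [k] weighs at most as much as [h]; this forces it to be even and diagonal. *)
  have stk : ((if lower k then N.+1 else if par k then N else lr k) <= lr h)%N.
    rewrite -(leq_add2r (wstat v)) /wstat -stE addnC -/(wstat w') stw' addnC.
    by rewrite leq_add2l.
  have [nlk npk {}stk] : [/\ lower k = false, par k = false & (lr k <= lr h)%N].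
    move: stk; case: (lower k) => [|].
      by rewrite leqNgt (ltn_trans (lr_lt h)).
    by case: (par k) => //; rewrite leqNgt lr_lt.
  have kd : lr k = lc k by move: uk nlk; rewrite /upper /lower; case: ltngtP.
  have wk j : lwt j y' = - lwt j a.
    have := c_wt ck j; rewrite [lwt j k]lwtE uk nlk /= subrr.
    by move/esym/eqP; rewrite addrC addr_eq0 => /eqP.
  (* As [k] is diagonal and even, [y'] has the root opposite to that of [a] and the parity of
     [a]. *)
  have ey : y' = y.
    have wy' j : (lc y' <= j < lr y')%N = (lr a <= j < lc a)%N.
      have := wk j; rewrite [lwt j a]lwt_upper // lwtE ly'.
      have -> : upper y' = false.
        by apply: contraTF ly' => uy; rewrite (upper_lower uy).
      by rewrite /=; case: (lc y' <= j < lr y')%N; case: (lr a <= j < lc a)%N.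
    have [E1 E2] := nat_interval_inj ly' ua wy'.
    apply: letter_inj; last by rewrite E1 ar.
      by have := c_par ck; rewrite npk -pay; case: par; case: par.
    by rewrite E2 ac.
  rewrite ey in ck pv; have hk := hmin _ ck.
  have kh : k = h.
    apply: letter_inj; first by rewrite npk (negbTE ph).
      by apply/eqP; rewrite eqn_leq hk stk.
    by rewrite -kd -hd; apply/eqP; rewrite eqn_leq hk stk.
  split=> //; apply: std_perm => //; rewrite kh in pv; rewrite -(perm_cons h).
  apply: (@perm_trans _ (y :: w')); first by rewrite perm_sym.
  apply: (@perm_trans _ (y :: h :: rem y w)); first by rewrite perm_cons.
  rewrite -[y :: _ :: _]/([:: y] ++ [:: h] ++ rem y w) perm_catCA /= perm_cons.
  by rewrite perm_sym; exact: perm_to_rem.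
rewrite wcoef_adw; have [vw|vw] := eqVneq v w; last first.
  apply/negbTE; rewrite negbK; apply/eqP; rewrite big1 // => i _.
  rewrite big1 ?mulr0 // => k _; apply/eqP; rewrite mulf_eq0.
  apply: contraNT vw; rewrite negb_or => /andP[c0 C0].
  by have [_ _ ->] := term i k (ltn_ord i) c0 C0.
subst v; pose C := wcoef (wprod (h :: rem y w)) w'.
have C0 : C != 0 by apply: wcoef_wprod_perm => //; rewrite perm_sym.
pose D := c a y h * C; have D0 : D != 0 by rewrite mulf_neq0.
have inner (i : 'I_(size w)) :
    \sum_k c a (nth a w i) k * wcoef (wprod (take i w ++ k :: drop i.+1 w)) w' =
    (nth a w i == y)%:R * D.
  have [E|E] := eqVneq (nth a w i) y; last first.
    rewrite mul0r big1 // => k _; apply/eqP; rewrite mulf_eq0.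
    apply: contraNT E; rewrite negb_or => /andP[c0 K0].
    by have [-> _ _] := term i k (ltn_ord i) c0 K0.
  rewrite (bigD1 h) //= big1 => [|k kh]; last first.
    apply/eqP; rewrite mulf_eq0.
    apply: contraNT kh; rewrite negb_or => /andP[c0 K0].
    by have [_ -> _] := term i k (ltn_ord i) c0 K0.
  have tdE : w = take i w ++ y :: drop i.+1 w.
    by rewrite -{1}(cat_take_drop i w) (drop_nth a) // E.
  rewrite addr0 mul1r E /D; congr (_ * _); rewrite wcoef_wprod_even //; last first.
    by rewrite szw' [X in (_ <= size X)%N]tdE !size_cat.
  rewrite /C; congr (wcoef (wprod (_ :: _)) _).
  apply: std_perm.
  - apply: (std_subseq _ sw); rewrite [X in subseq _ X]tdE.
    by rewrite cat_subseq // subseq_cons.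
  - by apply: (std_subseq _ sw); exact: rem_subseq.
  rewrite -(perm_cons y) -[y :: _ ++ _]/([:: y] ++ take i w ++ drop i.+1 w).
  by rewrite perm_catCA -tdE perm_to_rem.
under eq_bigr => i _ do rewrite inner mulrA.
rewrite -mulr_suml mulf_neq0 //.
have [i0 i0w Ei0] := (nthP a yw).
(* Each occurrence of [y] contributes [D] up to sign. An odd [y] occurs once; for an even one there
   are no signs, and a positive number of equal terms does not cancel. *)
have [pa|pa] := boolP (par a); last first.
  under eq_bigr => i _ do rewrite mul1r.
  rewrite (bigD1 (Ordinal i0w)) //= Ei0 eqxx -natr_sum -natrD pnatr_eq0.
  by rewrite addn_eq0.
rewrite (bigD1 (Ordinal i0w)) //= Ei0 eqxx mulr1 big1 ?addr0 ?signr_eq0 //.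
move=> i ii0; rewrite (_ : nth a w i == y = false) ?mulr0 //.
apply: contraNF ii0 => /eqP Ei; apply/eqP/val_inj => /=.
apply: (std_odd_nth sw (y := y)) => //; first by rewrite -pay.
  by rewrite (set_nth_default a).
by rewrite (set_nth_default a).
Qed.

Lemma wheight_size w : (wheight w <= N * size w)%N.
Proof.
rewrite /wheight -[X in (_ <= X * _)%N](card_ord N) -sum_nat_const.
apply: leq_sum => j _; rewrite /wnu -sum1_size; apply: leq_sum => a _.
exact: leq_b1.
Qed.

(** * Families of height components annihilated by the adjoint action *)

Variables (ad_letter : X -> U -> U) (ad_diag : nat -> U -> U).
Hypothesis ad_letter_linear : forall a, linear (ad_letter a).
Hypothesis ad_diag_linear : forall j, linear (ad_diag j).
Hypothesis ad_letterE : forall a w,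
  ad_letter a (wprod w) = adw a (wpar par w) (wprod w).
Hypothesis ad_diagE : forall j w,
  ad_diag j (wprod w) = (\sum_(a <- w) lwt j a)%:~R *: wprod w.
Hypothesis opposite : forall y, lower y -> exists a h,
  [/\ upper a, lr a = lc y, lc a = lr y, par a = par y & c a y h != 0].

Variable S : nat -> U.
Hypothesis S_span : forall h : nat,
  wspan (fun w => std w /\ wheight w = h) (S h).
(** Convergence to zero of [T] on the partial sums, expressed in coordinates. *)
Definition vanishes (T : U -> U) := forall k : nat, exists M, forall m, (M <= m)%N ->
  forall w, std w -> (wheight w < k)%N -> wcoef (T (\sum_(h < m) S h)) w = 0.
Hypothesis ad_letter0 : forall a, upper a -> vanishes (ad_letter a).
Hypothesis ad_diag0 : forall j, vanishes (ad_diag j).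

Let zc w := wcoef (S (wheight w)) w.

Lemma graded_expand (h : nat) : exists r : seq (seq X),
  [/\ uniq r, forall v, v \in r -> std v /\ wheight v = h &
      S h = \sum_(v <- r) zc v *: wprod v].
Proof.
have [l ls E] := S_span h; exists (undup [seq p.2 | p <- l]).
have rP v : v \in undup [seq p.2 | p <- l] -> std v /\ wheight v = h.
  by rewrite mem_undup => /mapP[p /ls ? ->].
split=> //; first exact: undup_uniq.
rewrite E lin_regroup big_seq [RHS]big_seq; apply: eq_bigr => v /rP[_ hv].
by rewrite /zc hv E wcoef_lin // => p /ls[].
Qed.

Let R h := projT1 (cid (graded_expand h)).
Let R_uniq h : uniq (R h).
Proof. by rewrite /R; case: cid => r []. Qed.
Let R_mem h v : v \in R h -> std v /\ wheight v = h.
Proof. by rewrite /R; case: cid => r [? H ?]; exact: H. Qed.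
Let SE (h : nat) : S h = \sum_(v <- R h) zc v *: wprod v.
Proof. by rewrite /R; case: cid => r []. Qed.

Let R_zc w : std w -> zc w != 0 -> w \in R (wheight w).
Proof.
move=> ws; rewrite /zc SE wcoef_sum => [|v _ _]; last first.
  by apply: wspanZ; exact: wprod_std.
apply: contraNT => wR; rewrite big_seq big1 // => v vR.
have [vs _] := R_mem vR.
rewrite wcoefZ ?wcoef_wprod //; last exact: wprod_std.
by case: eqVneq vR => [->|]; rewrite ?(negbTE wR) ?mulr0.
Qed.

Let wcoef_image (T : U -> U) m w : linear T ->
    (forall v, wspan std (T (wprod v))) ->
  wcoef (T (\sum_(h < m) S h)) w =
  \sum_(h < m) \sum_(v <- R h) zc v * wcoef (T (wprod v)) w.
Proof.
move=> Tl Ts; have -> : T (\sum_(h < m) S h) =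
    \sum_(h < m) \sum_(v <- R h) zc v *: T (wprod v).
  under eq_bigr do rewrite -[S _]scale1r.
  rewrite linear_comb //; apply: eq_bigr => h _.
  by rewrite scale1r SE linear_comb.
rewrite wcoef_sum => [|h _ _]; last by apply: wspan_sum => v _ _; exact: wspanZ.
apply: eq_bigr => h _; rewrite wcoef_sum => [|v _ _]; last exact: wspanZ.
by apply: eq_bigr => v _; rewrite wcoefZ.
Qed.

(** Standard words are eigenvectors of [ad_diag j], so the coefficient at [w] receives a
    contribution from [w] alone. *)
Lemma zc_weight w j : std w -> zc w != 0 -> \sum_(a <- w) lwt j a = 0.
Proof.
move=> ws wz; have [M HM] := ad_diag0 j (wheight w).+1.
have {HM} := HM (M + (wheight w).+1)%N (leq_addr _ _) w ws (ltnSn _).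
rewrite wcoef_image //; last first.
  by move=> v; rewrite ad_diagE; apply: wspanZ; exact: wprod_std.
have hm : (wheight w < M + (wheight w).+1)%N by rewrite addnS ltnS leq_addl.
rewrite (bigD1 (Ordinal hm)) //= [X in _ + X]big1 ?addr0; last first.
  move=> h hw; rewrite big_seq big1 // => v /R_mem[vs hv].
  rewrite ad_diagE wcoefZ ?wcoef_wprod //; last exact: wprod_std.
  case: eqVneq => [E|]; rewrite ?mulr0 //.
  by move/eqP: hw; case; apply: val_inj; rewrite /= -hv E.
rewrite (bigD1_seq w) ?R_zc //= big_seq_cond big1 ?addr0; last first.
  move=> v /andP[/R_mem[vs _] vw].
  rewrite ad_diagE wcoefZ ?wcoef_wprod //; last exact: wprod_std.
  by rewrite (negbTE vw) !mulr0.
rewrite ad_diagE wcoefZ ?wcoef_wprod //; last exact: wprod_std.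
by rewrite eqxx mulr1 => /eqP; rewrite mulf_eq0 (negbTE wz) intr_eq0 => /eqP.
Qed.

(** The positive weight of the upper letters can only be compensated by lower ones. *)
Lemma zc_lower w : std w -> zc w != 0 -> (0 < wheight w)%N ->
  exists2 y, y \in w & lower y.
Proof.
move=> ws wz; rewrite lt0n => h0; apply: contrapT => nl.
have {}nl y : y \in w -> ~~ lower y by move=> yw; apply/negP => ly; apply: nl; exists y.
move/eqP: h0; apply; rewrite /wheight big1 // => j _.
apply/eqP; rewrite -eqz_nat; apply/eqP; apply: etrans (zc_weight j ws wz).
rewrite /wnu (big_morph Posz PoszD (erefl _)) big_seq [RHS]big_seq.
apply: eq_bigr => a /nl la; rewrite lwtE (negbTE la) subr0.
by [].
Qed.

(** The bound is the greatest length in height 0. By induction on the height, a longer word would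
    leave an uncancelled term in a bracket with n^+. *)
Theorem size_bound : exists d, forall w, std w -> zc w != 0 -> (size w <= d)%N.
Proof.
have Rmax h : exists d, forall w, w \in R h -> (size w <= d)%N.
  exists (\max_(v <- R h) size v) => w wR.
  by rewrite (big_rem w) //= leq_maxl.
have [d Hd] := Rmax 0%N; exists d.
suff main (h : nat) w : wheight w = h -> std w -> zc w != 0 -> (size w <= d)%N.
  by move=> w; exact: main.
elim/ltn_ind: h w => h IH w0 hw0 w0s w0z.
have [h0|hpos] := posnP h.
  by apply: Hd; rewrite -h0 -hw0; exact: R_zc.
rewrite leqNgt; apply/negP => w0d.
pose P sz := `[< exists w, [/\ wheight w = h, std w, zc w != 0 & size w = sz] >].
have exP : exists sz, P sz by exists (size w0); apply/asboolP; exists w0.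
have [dh Hdh] := Rmax h.
have Pmax sz : P sz -> (sz <= dh)%N.
  move=> /asboolP[w [wh ws wz <-]]; apply: Hdh.
  by rewrite -wh; exact: R_zc.
case: (ex_maxnP exP Pmax) => sz /asboolP[w1 [w1h w1s w1z w1e]] emax.
have de : (d < sz)%N.
  by apply: leq_trans w0d _; apply: emax; apply/asboolP; exists w0.
(* Least [wstat] among the longest words of height [h], as [adw_leading] compares [w] only with
   words of no smaller statistic. *)
pose Q s := `[< exists w, [/\ wheight w = h, std w, zc w != 0, size w = sz &
   wstat w = s] >].
have exQ : exists s, Q s by exists (wstat w1); apply/asboolP; exists w1.
case: (ex_minnP exQ) => s /asboolP[w [wh ws wz we wS]] smin.
have [y yw ly] : exists2 y, y \in w & lower y by apply: zc_lower; rewrite ?wh.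
have [a [h1 [ua ar ac pay ch1]]] := opposite ly.
(* The letter [x] of least row in the bracket gives the target [w'] that isolates [w]. *)
pose T (k : nat) := `[< exists2 x, c a y x != 0 & lr x = k >].
have exT : exists i, T i by exists (lr h1); apply/asboolP; exists h1.
case: (ex_minnP exT) => k /asboolP[x cx lx] kmin.
have xmin z : c a y z != 0 -> (lr x <= lr z)%N.
  by move=> cz; rewrite lx; apply: kmin; apply/asboolP; exists z.
have px : ~~ par x by rewrite (c_par cx) pay addbb.
have [w' ws' pw'] := std_insert px (std_subseq (rem_subseq y w) ws).
have sw' : size w' = sz.
  by rewrite (perm_size pw') /= -we (perm_size (perm_to_rem yw)).
have [hxu hyu] : upper x = false /\ upper y = false.
  split; apply/negP => ux; last by rewrite (upper_lower ux) in ly.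
  have := c_wt cx (lr x); rewrite lwt_lr // lwt_upper // lwtE ly.
  have -> : upper y = false by apply/negP => uy; rewrite (upper_lower uy) in ly.
  by rewrite /= ar ac sub0r subrr.
have hw' : wheight w' = h.
  rewrite -wh (wheight_perm pw') (wheight_perm (perm_to_rem yw)).
  by apply: eq_bigr => j _; rewrite !wnu_cons hxu hyu.
have ad_std v : wspan std (ad_letter a (wprod v)).
  rewrite ad_letterE adw_wprod; apply: wspan_sum => i _ _; apply: wspanZ.
  by apply: wspan_sum => z _ _; apply: wspanZ; exact: wprod_std.
have ad_small v : (size v < sz)%N -> wcoef (ad_letter a (wprod v)) w' = 0.
  move=> ve; rewrite ad_letterE wcoef_adw big1 // => i _.
  rewrite big1 ?mulr0 // => z _; rewrite wcoef_wprod_lt ?mulr0 //.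
  have /= [] := perm_size (take_drop_perm a z (ltn_ord i)) => ->.
  by rewrite sw'.
have [M HM] := ad_letter0 ua h.+1.
have := HM (M + h.+1)%N (leq_addr _ _) w' ws'; rewrite hw' => /(_ (ltnSn _)).
rewrite wcoef_image //.
have hm : (h < M + h.+1)%N by rewrite addnS ltnS leq_addl.
(* Lower heights hold only words of length at most [d], too short to reach [w']; higher ones cannot
   descend to height [h]. *)
rewrite (bigD1 (Ordinal hm)) //= [X in _ + X]big1 ?addr0; last first.
  move=> i ih; rewrite big_seq big1 // => v vR; have [vs vh] := R_mem vR.
  have [lt|gt|E] := ltngtP (wheight v) h.
  - have [->|vz] := eqVneq (zc v) 0; first by rewrite mul0r.
    by rewrite ad_small ?mulr0 // (leq_ltn_trans (IH _ lt _ erefl vs vz)).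
  - rewrite [wcoef _ _](_ : _ = 0) ?mulr0 //; apply/eqP/negPn/negP.
    rewrite ad_letterE => /(wcoef_span (fun _ => @proj1 _ _)
      (adw_ge_height (wpar par v) ua vs))[_].
    by rewrite hw' leqNgt gt.
  - by move/eqP: ih; case; apply: val_inj; rewrite /= -vh.
have wR : w \in R h by rewrite -wh; exact: R_zc.
have lead v : std v -> size v = sz -> wheight v = h -> (wstat w <= wstat v)%N ->
    (wcoef (ad_letter a (wprod v)) w' != 0) = (v == w).
  move=> vs ve vh vS; rewrite ad_letterE.
  by apply: adw_leading ws ws' vs yw ua ly ar ac pay cx xmin pw' _ _ vS;
    rewrite ?ve ?vh.
rewrite (bigD1_seq w) //= big_seq_cond big1 ?addr0.
  by move/eqP; apply/negP; rewrite mulf_neq0 ?lead.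
move=> v /andP[vR vw]; have [vs vh] := R_mem vR.
have [->|vz] := eqVneq (zc v) 0; first by rewrite mul0r.
have := emax (size v); rewrite leq_eqVlt => /(_ _)/orP[|/eqP ve|ve].
- by apply/asboolP; exists v.
- apply/eqP; rewrite mulf_eq0 (negbTE vz) /=; apply: contraNT vw.
  rewrite lead // wS; apply: smin; apply/asboolP.
  by exists v.
- by rewrite ad_small ?mulr0.
Qed.

(** A letter adds at most [N] to the height, so bounded length bounds the height. *)
Theorem graded_finite : exists M, forall h, (M <= h)%N ->
  forall w, wcoef (S h) w = 0.
Proof.
have [d Hd] := size_bound; exists (N * d).+1 => h Mh w.
apply/eqP/negPn/negP => hw.
have [ws wh] := wcoef_span (fun _ => @proj1 _ _) (S_span h) hw.
have := Hd w ws; rewrite /zc wh hw => /(_ isT) wd.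
have := leq_trans (wheight_size w) (leq_mul (leqnn N) wd).
by rewrite wh leqNgt Mh.
Qed.

End Graded.
End PBW.

(** * Bases of the Q-type superalgebras *)

Section MatrixLetters.
Variables (K : numFieldType) (t : qtype) (m : nat).
Local Notation N := m.+1.
Local Notation M := 'M[K]_N.
Implicit Types (A B : M) (p q : bool).

Definition special := if t is (Tsq | Tpsq) then true else false.
Definition projective := if t is (Tpq | Tpsq) then true else false.

(* (parity, row, column); the diagonal basis matrices not needed to span the  *)
(* traceless matrices, respectively the matrices modulo the identity, are     *)
(* left out.                                                                  *)
Definition letter_ok (x : bool * 'I_N * 'I_N) : bool :=
  ~~ [&& x.1.2 == x.2, x.2 == 0 & if x.1.1 then special else projective].
Definition letter := {x | letter_ok x}.
HB.instance Definition _ := Finite.on letter.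

Definition lpar (x : letter) : bool := (val x).1.1.
Definition lrow (x : letter) : 'I_N := (val x).1.2.
Definition lcol (x : letter) : 'I_N := (val x).2.

Lemma letter_eqE x y :
  (x == y) = [&& lpar x == lpar y, lrow x == lrow y & lcol x == lcol y].
Proof. by rewrite -val_eqE -!pair_eqE /= andbA. Qed.

(** Subtracting the corner unit makes odd diagonal letters traceless in the special types. *)
Definition lmx x : M := delta_mx (lrow x) (lcol x) -
  (if [&& lpar x, special & lrow x == lcol x] then delta_mx 0 0 else 0).

(** Subtracting the corner entry makes even diagonal coordinates invariant under adding scalar
    matrices in the projective types. *)
Definition lcoord x A : K := A (lrow x) (lcol x) -
  (if [&& ~~ lpar x, projective & lrow x == lcol x] then A 0 0 else 0).

Definition mx_dom p A : Prop := p && special -> \tr A = 0.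

Definition mx_br p q A B : M := A *m B - (-1) ^+ (p && q) *: (B *m A).

Lemma letterN0 x : lrow x = 0 -> lcol x = 0 ->
  (if lpar x then special else projective) = false.
Proof.
move=> r0 c0; have := valP x; rewrite /letter_ok -/(lrow x) -/(lcol x) r0 c0.
exact: negbTE.
Qed.

Lemma lmxE x i j : (if lpar x then special else projective) && (i == 0) && (j == 0)
  = false -> lmx x i j = ((i == lrow x) && (j == lcol x))%:R.
Proof.
move=> h; rewrite !mxE; case: ifP => [/and3P[px sp _]|_]; last first.
  by rewrite !mxE subr0.
rewrite px sp /= in h; rewrite !mxE h subr0 //.
Qed.

Lemma lmx_projective00 x : ~~ lpar x -> projective -> lmx x 0 0 = 0.
Proof.
move=> px pr; rewrite !mxE (negbTE px) /= mxE subr0.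
case: eqVneq => //= r0; case: eqVneq => //= c0.
by have := letterN0 (esym r0) (esym c0); rewrite (negbTE px) pr.
Qed.

Lemma lcoord_lmx x y : lpar x = lpar y -> lcoord x (lmx y) = (x == y)%:R.
Proof.
move=> pxy; rewrite /lcoord lmxE; last first.
  apply/negbTE/negP => /andP[/andP[h /eqP r0] /eqP c0].
  by have := letterN0 r0 c0; rewrite pxy h.
rewrite letter_eqE pxy eqxx /=; case: ifP => [/and3P[px pr _]|_]; last first.
  by rewrite subr0.
by rewrite lmx_projective00 ?subr0.
Qed.

Lemma lcoord_linear x : linear (lcoord x : M -> K^o).
Proof.
move=> k A B; rewrite /lcoord !mxE; case: ifP => _; last by rewrite !subr0.
by rewrite scalerBr opprD addrACA.
Qed.

Lemma mxtrace_delta i j : \tr (delta_mx i j : M) = (i == j)%:R.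
Proof.
rewrite /mxtrace (bigD1 i) //= big1 => [|k ki]; last by rewrite mxE (negbTE ki).
by rewrite mxE eqxx addr0.
Qed.

Lemma lmx_dom x : mx_dom (lpar x) (lmx x).
Proof.
rewrite /mx_dom /lmx => /andP[-> ->] /=.
rewrite linearB /= mxtrace_delta; case: eqVneq => _.
  by rewrite mxtrace_delta eqxx subrr.
by rewrite linear0 subr0.
Qed.

(** Entries carrying a letter agree directly. A missing corner is recovered from the trace in the
    odd case and from the scalar term, which dies in the quotient, in the even case. *)
Lemma mx_expand p A : mx_dom p A ->
  A = \sum_(x | lpar x == p) lcoord x A *: lmx x +
      (if ~~ p && projective then A 0 0 else 0)%:M.
Proof.
move=> Ad; set S := \sum_(x | _) _; set s := (X in X%:M).
have good i j : ~~ [&& i == j, j == 0 & if p then special else projective] ->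
    A i j = (S + s%:M) i j.
  move=> ok; pose x : letter := exist _ (p, i, j) ok.
  have Sij : S i j = lcoord x A.
    rewrite summxE (bigD1 x) //= big1 ?addr0 => [|y /andP[/eqP py yx]].
      rewrite mxE lmxE ?eqxx ?mulr1 //= .
      by apply/negbTE; move: (ok); apply: contra => /andP[/andP[-> /eqP->] /eqP->]; rewrite !eqxx.
    rewrite mxE lmxE; last first.
      rewrite py; apply/negbTE; move: (ok); apply: contra => /andP[/andP[-> /eqP->] /eqP->].
      by rewrite !eqxx.
    move: yx; rewrite letter_eqE py eqxx /= !(eq_sym _ i) !(eq_sym _ j).
    by move=> /negbTE ->; rewrite mulr0.
  rewrite mxE Sij /lcoord -[lrow x]/i -[lcol x]/j -[lpar x]/p /s !mxE.
  case: (~~ p) => /=; last by rewrite mul0rn subr0 addr0.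
  case: projective => /=; last by rewrite mul0rn subr0 addr0.
  by case: (i == j); rewrite ?subrK // subr0 addr0.
apply/matrixP => i j.
have [/and3P[/eqP ij /eqP j0]|] :=
  boolP [&& i == j, j == 0 & if p then special else projective]; last exact: good.
rewrite ij j0 => {i j ij j0}; case: p Ad @S @s good => Ad S s good fl.
  have tS : \tr (S + s%:M) = 0.
    rewrite linearD /= mxtrace_scalar /s /= mul0rn addr0.
    rewrite linear_sum big1 //= => x /eqP px; rewrite linearZ /=.
    by have := @lmx_dom x; rewrite /mx_dom px fl => ->; rewrite ?mulr0.
  have tA : \tr A = 0 by apply: Ad; rewrite fl.
  have tr0 B : \tr B = B 0 0 + \sum_(i | i != 0) B i i.
    by rewrite /mxtrace (bigD1 0).
  rewrite !tr0 in tA tS; move: tA; rewrite (eq_bigr (fun i => (S + s%:M) i i)).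
    move=> tA; apply: (@addIr _ (\sum_(i | i != 0) (S + s%:M) i i)).
    exact: etrans tA (esym tS).
  by move=> i i0; apply: good; rewrite (negbTE i0) andbF.
rewrite mxE summxE big1 => [|x /eqP px]; last first.
  by rewrite mxE lmx_projective00 ?px ?mulr0.
by rewrite /s fl add0r mxE eqxx mulr1n.
Qed.

Lemma mx_br_linearl p q B : linear (mx_br p q ^~ B).
Proof.
move=> k A A'; rewrite /mx_br mulmxDl mulmxDr -scalemxAl -scalemxAr.
by rewrite !scalerDr scalerN opprD addrACA !scalerA [_ * k]mulrC.
Qed.

Lemma mx_br_linearr p q A : linear (mx_br p q A).
Proof.
move=> k B B'; rewrite /mx_br mulmxDl mulmxDr -scalemxAl -scalemxAr.
by rewrite !scalerDr scalerN opprD addrACA !scalerA [_ * k]mulrC.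
Qed.

Lemma mx_br_scalarl q s B : mx_br false q s%:M B = 0.
Proof. by rewrite /mx_br scale1r scalar_mxC subrr. Qed.

Lemma mx_br_scalarr p s A : mx_br p false A s%:M = 0.
Proof. by rewrite /mx_br andbF scale1r scalar_mxC subrr. Qed.

Lemma mx_br_dom p q A B : mx_dom (p (+) q) (mx_br p q A B).
Proof.
move=> /andP[pq _]; rewrite /mx_br linearB /= linearZ /=.
by rewrite mxtrace_mulC; case: p q pq => [] [] //= _; rewrite mul1r subrr.
Qed.

Definition lbr (a b k : letter) : K :=
  if lpar k == lpar a (+) lpar b
  then lcoord k (mx_br (lpar a) (lpar b) (lmx a) (lmx b)) else 0.

Lemma lbr_par a b k : lbr a b k != 0 -> lpar k = lpar a (+) lpar b.
Proof. by rewrite /lbr; case: ifP => [/eqP //|_]; rewrite eqxx. Qed.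

(* Bracketing with [cut_mx j] measures the coefficient of the [j]-th simple   *)
(* root.                                                                      *)
Definition cut_mx (j : nat) : M := \matrix_(i, k) ((i == k) && (i <= j)%N)%:R.

Lemma comm_cut j A i k :
  mx_br false false (cut_mx j) A i k =
  ((i <= j)%N%:Z - (k <= j)%N%:Z)%:~R * A i k.
Proof.
rewrite /mx_br scale1r !mxE (bigD1 i) //= big1 => [|l li]; last first.
  by rewrite mxE eq_sym (negbTE li) mul0r.
rewrite (bigD1 k) //= big1 => [|l lk]; last first.
  by rewrite mxE (negbTE lk) mulr0.
by rewrite !mxE !eqxx !addr0 intrB mulrBl [A i k * _]mulrC.
Qed.

Definition lrown x : nat := lrow x.
Definition lcoln x : nat := lcol x.
Local Notation lwt := (lwt lrown lcoln).

Lemma comm_cut_lmx j x :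
  mx_br false false (cut_mx j) (lmx x) = (lwt j x)%:~R *: lmx x.
Proof.
apply/matrixP => i k; rewrite comm_cut mxE /lmx !mxE.
case: eqVneq => [-> /=|_ /=].
  case: eqVneq => [-> /=|_ /=].
    by [].
  case: ifP => [/and3P[_ _ /eqP rc]|_]; last by rewrite !mxE subrr !mulr0.
  rewrite !mxE /lwt /lrown /lcoln rc subrr mul0r.
  case: eqVneq => [->|_]; last by rewrite subrr mulr0.
  by case: eqVneq => [->|_]; rewrite ?subrr ?mulr0 ?mul0r.
case: ifP => [/and3P[_ _ /eqP rc]|_]; last by rewrite !mxE subrr !mulr0.
rewrite !mxE /lwt /lrown /lcoln rc subrr mul0r.
case: eqVneq => [->|_]; last by rewrite subrr mulr0.
by case: eqVneq => [->|_]; rewrite ?subrr ?mulr0 ?mul0r.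
Qed.

Lemma lcoord_comm_cut j x A :
  lcoord x (mx_br false false (cut_mx j) A) = (lwt j x)%:~R * lcoord x A.
Proof.
rewrite /lcoord !comm_cut mulrBr; congr (_ - _).
case: ifP => [/and3P[_ _ /eqP rc]|_]; last by rewrite mulr0.
by rewrite /lwt /lrown /lcoln rc !subrr !mul0r.
Qed.

Lemma mx_br_jacobi p q C A B :
  mx_br false false C (mx_br p q A B) =
  mx_br p q (mx_br false false C A) B + mx_br p q A (mx_br false false C B).
Proof.
rewrite /mx_br !scale1r !(mulmxBl, mulmxBr) -!scalemxAl -!scalemxAr.
rewrite !mulmxA !scalerBr.
move: (C *m A *m B) (C *m B *m A) (A *m B *m C) (B *m A *m C)
  (A *m C *m B) (B *m C *m A) => a b c d e f.
by apply/matrixP=> i j; rewrite !mxE; ring.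
Qed.

(** Bracketing with [cut_mx j] is a derivation with the letters as eigenvectors; eigenvalues are
    compared as integers in characteristic zero. *)
Lemma lbr_weight a b k : lbr a b k != 0 -> forall j, lwt j k = lwt j a + lwt j b.
Proof.
rewrite /lbr; case: ifP => [_ c0 j|_]; last by rewrite eqxx.
set B := mx_br _ _ _ _ in c0.
have : (lwt j k)%:~R * lcoord k B = (lwt j a + lwt j b)%:~R * lcoord k B.
  rewrite -lcoord_comm_cut mx_br_jacobi !comm_cut_lmx.
  have -> : mx_br (lpar a) (lpar b) ((lwt j a)%:~R *: lmx a) (lmx b) =
      (lwt j a)%:~R *: B.
    have := mx_br_linearl (lpar a) (lpar b) (lmx b) (lwt j a)%:~R (lmx a) 0.
    by rewrite /mx_br !mul0mx !mulmx0 scaler0 subrr !addr0.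
  have -> : mx_br (lpar a) (lpar b) (lmx a) ((lwt j b)%:~R *: lmx b) =
      (lwt j b)%:~R *: B.
    have := mx_br_linearr (lpar a) (lpar b) (lmx a) (lwt j b)%:~R (lmx b) 0.
    by rewrite /mx_br !mul0mx !mulmx0 scaler0 subrr !addr0.
  rewrite -scalerDl -intrD; have := lcoord_linear k (lwt j a + lwt j b)%:~R B 0.
  rewrite !addr0 => ->; rewrite /lcoord !mxE.
  by case: ifP; rewrite subrr addr0.
by move/(mulIf c0)/eqP; rewrite eqr_int => /eqP.
Qed.

Lemma letter_inj a b : lpar a = lpar b -> lrown a = lrown b ->
  lcoln a = lcoln b -> a = b.
Proof.
move=> pab rab cab; apply/eqP; rewrite letter_eqE pab eqxx /=.
by rewrite -!val_eqE /= -/(lrown _) -/(lcoln _) rab cab !eqxx.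
Qed.

Definition lrank (x : letter) : nat :=
  ((if lrown x < lcoln x then #|{: letter}| else 0) + enum_rank x)%N.

Lemma lrank_upper a b : ~~ upper lrown lcoln a -> upper lrown lcoln b ->
  (lrank a < lrank b)%N.
Proof.
rewrite /upper /lrank => /negbTE -> ->.
by rewrite add0n ltn_addr // ltn_ord.
Qed.

Lemma lrank_inj : injective lrank.
Proof.
move=> a b ab; have := @lrank_upper a b; have := @lrank_upper b a.
rewrite ab ltnn; move: ab; rewrite /lrank /upper; case: ltnP => ra; case: ltnP => rb /=.
- by move/addnI/ord_inj/enum_rank_inj.
- by move=> _ /(_ isT isT).
- by move=> _ _ /(_ isT isT).
- by rewrite !add0n => /ord_inj/enum_rank_inj.
Qed.

Lemma mx_br_delta p (i j : 'I_N) : i != j ->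
  mx_br p p (delta_mx i j) (delta_mx j i) =
  delta_mx i i - (-1) ^+ p *: delta_mx j j.
Proof. by move=> ij; rewrite /mx_br andbb !mul_delta_mx. Qed.

Lemma letter_opposite y : (projective -> (3 <= N)%N) -> lower lrown lcoln y ->
  exists a h, [/\ upper lrown lcoln a, lrown a = lcoln y, lcoln a = lrown y,
    lpar a = lpar y & lbr a y h != 0].
Proof.
move=> N3 ly; have cr : lcol y != lrow y.
  by apply: contraTneq ly => E; rewrite /lower /lrown /lcoln E ltnn.
have ok : letter_ok (lpar y, lcol y, lrow y) by rewrite /letter_ok /= (negbTE cr).
pose a : letter := exist _ (lpar y, lcol y, lrow y) ok.
suff [h hpar hd] : exists2 h : letter, ~~ lpar h & lrow h = lcol h /\
    lcoord h (delta_mx (lcol y) (lcol y) - (-1) ^+ (lpar y) *: delta_mx (lrow y) (lrow y)) != 0.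
  have la : lmx a = delta_mx (lcol y) (lrow y).
    by rewrite /lmx (_ : (lrow a == lcol a) = false) ?andbF ?subr0 //; exact: negbTE.
  have ly' : lmx y = delta_mx (lrow y) (lcol y).
    by rewrite /lmx (eq_sym (lrow y)) (negbTE cr) !andbF subr0.
  exists a, h; split=> //.
  rewrite /lbr -[lpar a]/(lpar y) addbb (negbTE hpar) /= la ly' mx_br_delta //.
  by case: hd.
have r0 : lrow y != 0.
  by apply: contraTneq ly => E; rewrite /lower /lrown /lcoln E.
have diag k : k != 0 -> exists2 h : letter, ~~ lpar h &
    lrow h = lcol h /\ (forall A, lcoord h A = A k k - (if projective then A 0 0 else 0)).
  move=> k0; have okk : letter_ok (false, k, k) by rewrite /letter_ok /= (negbTE k0) andbF.
  exists (exist _ (false, k, k) okk : letter) => //; split=> // A.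
  by rewrite /lcoord /lrow /lcol /lpar /= eqxx andbT.
have delta0 (i l k : 'I_N) (s : K) :
    (delta_mx i i - s *: delta_mx l l) k k = (k == i)%:R - s * (k == l)%:R.
  by rewrite !mxE !andbb.
have [c0|c0] := eqVneq (lcol y) 0; last first.
  have [h hp [hd hE]] := diag _ r0; exists h => //; split=> //.
  rewrite hE !delta0 eqxx (eq_sym (lrow y)) (negbTE cr) sub0r mulr1.
  rewrite ![0 == _]eq_sym (negbTE r0) (negbTE c0) mulr0 subr0 if_same subr0.
  by rewrite oppr_eq0 signr_eq0.
rewrite c0 in cr *.
have [pr|pr] := boolP projective; last first.
  have [h hp [hd hE]] := diag _ r0; exists h => //; split=> //.
  rewrite hE !delta0 eqxx (negbTE r0) sub0r mulr1 (negbTE pr) subr0.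
  by rewrite oppr_eq0 signr_eq0.
have [py|py] := boolP (lpar y).
  (* Modulo the identity, E_00 + E_rr has coordinate zero at [r]; a third index detects it with
     value -1. *)
  have [k k0 kr] : exists2 k : 'I_N, k != 0 & k != lrow y.
    have : (2 < #|[set: 'I_N]|)%N by rewrite cardsT card_ord; exact: N3.
    rewrite (cardsD1 0) (cardsD1 (lrow y)) !inE r0 !add1n !ltnS.
    by case/card_gt0P => k; rewrite !inE => /and3P[kr k0 _]; exists k.
  have [h hp [hd hE]] := diag _ k0; exists h => //; split=> //.
  rewrite hE pr !delta0 (negbTE k0) (negbTE kr) eqxx [0 == _]eq_sym (negbTE r0).
  by rewrite !mulr0 !subr0 sub0r oppr_eq0 oner_eq0.
have [h hp [hd hE]] := diag _ r0; exists h => //; split=> //.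
rewrite hE pr !delta0 !eqxx [0 == lrow y]eq_sym (negbTE r0).
rewrite expr0 mulr1 mulr0 subr0 sub0r -opprD oppr_eq0.
by rewrite -[1 + 1]/(2%:R) pnatr_eq0.
Qed.

End MatrixLetters.

(** * Coordinate functions as matrix coefficients *)

Section MatrixCoefficients.
Variables (K : numFieldType) (t : qtype) (m : nat).
Local Notation N := m.+1.
Local Notation M := 'M[K]_N.
Local Notation letter := (letter t m).
Local Notation V := (bool -> M).
Local Notation lmx := (@lmx K t m).
Implicit Types (A B C : M) (p q r : bool) (v : V) (a b k x : letter).

(* The pair (v false, v true) stands for a general element of q(n), on which  *)
(* the algebra acts by left multiplication or, when the identity has to act   *)
(* trivially, by the adjoint action.                                          *)
Definition qact p A v : V := fun r =>
  if projective t then mx_br p (r (+) p) A (v (r (+) p))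
  else A *m v (r (+) p).

Lemma mx_br_superjacobi p q r A B C :
  mx_br p (q (+) r) A (mx_br q r B C) -
    (-1) ^+ (p && q) *: mx_br q (p (+) r) B (mx_br p r A C) =
  mx_br (p (+) q) r (mx_br p q A B) C.
Proof.
rewrite /mx_br !(mulmxBl, mulmxBr) -!scalemxAl -!scalemxAr.
rewrite !mulmxA.
move: (A *m B *m C) (A *m C *m B) (B *m A *m C) (B *m C *m A)
  (C *m A *m B) (C *m B *m A) => a b c d e f.
by apply/matrixP=> i j; rewrite !mxE; case: p q r => [] [] [] /=; ring.
Qed.

Lemma qact_linearl p v : linear (fun A => qact p A v).
Proof.
move=> k A B; apply/funext => r; rewrite /qact !fctE.
case: (projective t); first exact: mx_br_linearl.
by rewrite mulmxDl -scalemxAl.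
Qed.

Lemma qact_linearr p A : linear (qact p A).
Proof.
move=> k v v'; apply/funext => r; rewrite /qact !fctE.
case: (projective t); first exact: mx_br_linearr.
by rewrite mulmxDr -scalemxAr.
Qed.

Lemma qact_scalar s v : (s != 0 -> projective t) -> qact false s%:M v = 0.
Proof.
move=> sp; apply/funext => r; rewrite /qact.
case: ifP => pr; first exact: mx_br_scalarl.
have -> : s = 0 by apply/eqP/negPn/negP => /sp; rewrite pr.
by rewrite -scalemx1 scale0r mul0mx.
Qed.

Lemma qact_comm p q A B v :
  qact p A (qact q B v) - (-1) ^+ (p && q) *: qact q B (qact p A v) =
  qact (p (+) q) (mx_br p q A B) v.
Proof.
apply/funext => r; rewrite /qact !fctE.
have E : r (+) q (+) p = r (+) p (+) q by rewrite -!addbA (addbC q).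
case: (projective t); last first.
  rewrite !E addbA /mx_br mulmxBl -!scalemxAl !mulmxA.
  by [].
have := mx_br_superjacobi p q (r (+) p (+) q) A B (v (r (+) p (+) q)).
rewrite !E [q (+) _]addbC addbK [p (+) _]addbC -E addbK addbA.
by rewrite -E.
Qed.

Definition lact a v : V := qact (lpar a) (lmx a) v.

Lemma lact_rel a b v :
  lact a (lact b v) - word_sign K (@lpar t m) a b *: lact b (lact a v) =
  \sum_k lbr K a b k *: lact k v.
Proof.
rewrite /lact /word_sign qact_comm.
have E := mx_expand (@mx_br_dom K t m (lpar a) (lpar b) (lmx a) (lmx b)).
set P := _ (+) _ in E *; set Y := mx_br _ _ _ _ in E *.
rewrite E -[X in qact _ (X + _)]scale1r qact_linearl scale1r.
rewrite [X in _ + X](_ : _ = 0) ?addr0; last first.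
  move: (Y 0 0) => s; clear E; case: P => /=.
    by apply/funext => r; rewrite /qact -scalemx1 scale0r /mx_br !mul0mx mulmx0
      scaler0 subrr if_same.
  by apply: qact_scalar; case: (projective t) => //; rewrite eqxx.
rewrite (linear_comb _ _ _ _ (qact_linearl P v)) big_mkcond.
apply: eq_bigr => k _; rewrite /lbr -/P -/Y; case: eqP => [->|_] //.
by rewrite scale0r.
Qed.

Lemma lact_linear a : linear (lact a).
Proof. exact: qact_linearr. Qed.

Lemma foldl_lact_linear w : linear (fun v => foldl (fun v a => lact a v) v w).
Proof.
elim: w => [|a w IH] k v v' //=.
by rewrite lact_linear IH.
Qed.

(** Without the quotient, acting on the identity matrix returns the acting matrix. In the adjoint
    action, E_jj exposes an off-diagonal entry (i,j), the even E_i0 exposes A_ii - A_00, and the odd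
    E_ii exposes 2 B_ii, whence the division by 2 in [coord_read]. *)
Definition coord_start x : V := fun r =>
  if projective t then
    if (lrow x == lcol x) && lpar x
    then if r then delta_mx (lcol x) (lcol x) else 0
    else if r then 0 else delta_mx (lcol x) (if lrow x == lcol x then 0 else lcol x)
  else if r then 0 else 1%:M.

Definition coord_read x (v : V) : K :=
  if projective t then
    if lrow x == lcol x then
      if lpar x then v false (lrow x) (lcol x) / 2 else v false (lrow x) 0
    else v (lpar x) (lrow x) (lcol x)
  else lcoord x (v (lpar x)).

(** Resetting the value at the empty word is harmless, as the relations involve only nonempty
    words. *)
Definition word_coord x (w : seq letter) : K^o :=
  if w is [::] then 0
  else coord_read x (foldl (fun v a => lact a v) (coord_start x) w).

Lemma coord_read_linear x : linear (coord_read x : V -> K^o).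
Proof.
move=> k v v'; rewrite /coord_read !fctE.
case: ifP => _; last exact: lcoord_linear.
case: ifP => _; last by rewrite !mxE.
by case: ifP => _; rewrite !mxE // mulrDl -[(k * _) / 2]mulrA.
Qed.

Lemma word_coord_rel x : wrel (@lpar t m) (@lbr K t m) (word_coord x).
Proof.
pose f w := coord_read x (foldl (fun v a => lact a v) (coord_start x) w).
have fE u a w : word_coord x (u ++ a :: w) = f (u ++ a :: w) by case: u.
move=> u w a b; rewrite !fE (eq_bigr (fun k => lbr K a b k * f (u ++ k :: w)));
  last by move=> k _; rewrite fE.
pose T v : K^o := coord_read x (foldl (fun v a => lact a v) v w).
have Tl : linear T by move=> k v v'; rewrite /T foldl_lact_linear coord_read_linear.
have Tf z : f (u ++ z ++ w) = T (foldl (fun v a => lact a v)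
    (foldl (fun v a => lact a v) (coord_start x) u) z).
  by rewrite /f /T !foldl_cat.
have := Tf [:: b; a]; have := Tf [:: a; b]; rewrite /= => -> ->.
under eq_bigr => k _ do rewrite (Tf [:: k]) /=.
set v := foldl _ (coord_start x) u.
rewrite -(linear_comb _ _ _ _ Tl) -lact_rel [X in _ = T X]addrC -scaleNr Tl.
by rewrite scaleNr addrC.
Qed.

Lemma word_coord0 x : word_coord x [::] = 0.
Proof. by []. Qed.

Lemma word_coord1 x b : word_coord x [:: b] = (x == b)%:R.
Proof.
rewrite /word_coord /= /coord_read /coord_start /lact /qact.
have [pr|pr] := boolP (projective t); last first.
  have [E|E] := eqVneq (lpar x) (lpar b).
    by rewrite E addbb mulmx1 lcoord_lmx.
  have -> : lpar x (+) lpar b by case: (lpar x) E; case: (lpar b).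
  rewrite mulmx0 letter_eqE (negbTE E) /= /lcoord !mxE.
  by case: ifP => _; rewrite ?mxE subrr.
have br0 p q B : mx_br p q B (0 : M) = 0.
  by rewrite /mx_br mulmx0 mul0mx scaler0 subrr.
have hmr B (i j k l : 'I_N) : (B *m delta_mx k l) i j = B i k *+ (j == l).
  rewrite mxE (bigD1 k) //= big1 => [|z zk]; last first.
    by rewrite mxE (negbTE zk) mulr0.
  by rewrite mxE eqxx addr0 mulr_natr.
have hml B (i j k l : 'I_N) : (delta_mx k l *m B) i j = B l j *+ (i == k).
  rewrite mxE (bigD1 l) //= big1 => [|z zk]; last first.
    by rewrite mxE (negbTE zk) andbF mul0r.
  by rewrite mxE eqxx andbT addr0 mulr_natl.
have hbr p q B (i j k l : 'I_N) : mx_br p q B (delta_mx k l) i j =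
    B i k *+ (j == l) - (-1) ^+ (p && q) * (B l j *+ (i == k)).
  have ent (A A' : M) s : (A - s *: A') i j = A i j - s * A' i j by rewrite !mxE.
  by rewrite /mx_br ent hmr hml.
have [E|E] := eqVneq (lpar x) (lpar b); last first.
  rewrite letter_eqE (negbTE E) /=; case: (eqVneq (lrow x)) => [rc|rc] /=.
    case px: (lpar x) E => E; case pb: (lpar b) E => E //=.
      by rewrite br0 mxE mul0r.
    by rewrite br0 mxE.
  have -> : lpar x (+) lpar b by case: (lpar x) E; case: (lpar b).
  by rewrite br0 mxE.
rewrite -(lcoord_lmx K E) /lcoord.
case: (eqVneq (lrow x)) => [rc|rc] /=; last first.
  rewrite E addbb hbr eqxx mulr1n (negbTE rc) mulr0n mulr0.
  by rewrite !andbF.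
case px: (lpar x) => /=; rewrite -E px /= hbr rc !eqxx !mulr1n.
  by rewrite mulN1r opprK subr0; field.
by rewrite pr expr0 mul1r.
Qed.

End MatrixCoefficients.

Section QuotientByIdentity.
Variables (K : numFieldType) (m : nat).
Local Notation N := m.+1.
Local Notation M := 'M[K]_N.
Local Notation Q := (Quotient.quot (submod_pred (Id_line K N))).

Lemma repr_pi_scalar (A : M) : exists s : K, repr (\pi_Q A) = A + s%:M.
Proof.
have /vlineP[s E] := repr_quotP (Id_line K N) A.
by exists s; rewrite -scalemx1 -E addrC subrK.
Qed.

Lemma pi_scalar (s : K) : \pi_Q (s%:M : M) = 0.
Proof.
rewrite -[RHS](scale0r (\pi_Q s%:M)) -pi_quotZ scale0r; apply: Defs.quotP.
by rewrite subr0 -scalemx1; apply/vlineP; exists s.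
Qed.
End QuotientByIdentity.

(** * Presentation of the enveloping algebras by matrix letters *)

Section QTypeBasis.
Variables (K : numFieldType) (t : qtype) (m : nat).
Local Notation N := m.+1.
Local Notation M := 'M[K]_N.
Local Notation L := (qtype_alg K t N).
Implicit Types (A B : M) (x : ls0 L) (y : ls1 L).

Definition even_mx : ls0 L -> M :=
  match t return ls0 (qtype_alg K t N) -> M with
  | Tq | Tsq => fun A => A
  | Tpq | Tpsq =>
    fun A : Quotient.quot (submod_pred (Id_line K N)) => repr A
  end.

Definition odd_elt : M -> ls1 L :=
  match t return M -> ls1 (qtype_alg K t N) with
  | Tq | Tpq => fun B => B
  | Tsq | Tpsq => fun B => vsproj (sl_space K N) B
  end.

Lemma Xeven_linear : linear (@Xeven K t N).
Proof.
rewrite /Xeven; case: t => // k A B; first by rewrite -pi_quotZ -pi_quotD.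
by rewrite -pi_quotZ -pi_quotD.
Qed.

Lemma Xodd_linear : linear (@Xodd K t N).
Proof. by rewrite /Xodd; case: t. Qed.

Lemma odd_elt_linear : linear odd_elt.
Proof. by rewrite /odd_elt; case: t => // k A B; rewrite linearP. Qed.

Lemma even_mxK x : Xeven t (even_mx x) = x.
Proof. by rewrite /even_mx; case: t x => // x; exact: reprK. Qed.

Lemma odd_eltK y : odd_elt (Xodd y) = y.
Proof. by rewrite /odd_elt /Xodd; case: t y => // y; exact: vsvalK. Qed.

Lemma Xodd_dom y : mx_dom t true (Xodd y).
Proof.
by rewrite /mx_dom /Xodd; case: t y => //= y _; apply/eqP;
  rewrite -sl_spaceP subvsP.
Qed.

Lemma XoddK B : mx_dom t true B -> Xodd (odd_elt B) = B.
Proof.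
rewrite /mx_dom /Xodd /odd_elt; case: t => //= /(_ isT) tB;
by rewrite vsprojK // sl_spaceP tB.
Qed.

Lemma even_mx_Xeven A :
  exists2 s : K, even_mx (Xeven t A) = A + s%:M & s != 0 -> projective t.
Proof.
rewrite /even_mx /Xeven; case: t => /=.
- by exists 0; rewrite ?eqxx // -scalemx1 scale0r addr0.
- by exists 0; rewrite ?eqxx // -scalemx1 scale0r addr0.
- by have [s ->] := repr_pi_scalar A; exists s.
- by have [s ->] := repr_pi_scalar A; exists s.
Qed.

Lemma Xeven_scalar (s : K) : projective t -> Xeven t (s%:M : M) = 0.
Proof. by rewrite /Xeven; case: t => // _; exact: pi_scalar. Qed.

Lemma mx_commE A B : mx_comm A B = mx_br false false A B.
Proof. by rewrite /mx_comm /mx_br scale1r. Qed.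

Lemma mx_comm_shift A B (s s' : K) :
  mx_comm (A + s%:M) (B + s'%:M) = mx_comm A B.
Proof.
rewrite /mx_comm !mulmxDl !mulmxDr (scalar_mxC s') -(scalar_mxC s).
rewrite (scalar_mxC s s'%:M) !opprD.
move: (A *m B) (B *m A) (s%:M *m B) (s'%:M *m A) => a b c d.
by apply/matrixP => i j; rewrite !mxE; ring.
Qed.

Lemma br00_Xeven A B :
  br00 (Xeven t A) (Xeven t B) = Xeven t (mx_br false false A B).
Proof.
rewrite -mx_commE /Xeven; case: t => //=; rewrite /cq00 /=;
  have [s ->] := repr_pi_scalar A; have [s' ->] := repr_pi_scalar B;
  by rewrite mx_comm_shift.
Qed.

Lemma Xodd_br01 A y :
  Xodd (br01 (Xeven t A) y) = mx_br false true A (Xodd y).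
Proof.
have -> : mx_br false true A (Xodd y) = mx_comm A (Xodd y).
  by rewrite /mx_comm /mx_br scale1r.
have sh (s : K) B : mx_comm (A + s%:M) B = mx_comm A B.
  by have := mx_comm_shift A B s 0; rewrite -(scalemx1 _ 0) scale0r addr0.
rewrite /Xodd /Xeven; case: t y => //= y; rewrite /cq01 /=;
  by have [s ->] := repr_pi_scalar A; rewrite sh.
Qed.

Lemma br11_Xodd y y' :
  br11 y y' = Xeven t (mx_br true true (Xodd y) (Xodd y')).
Proof.
have antiE A B : mx_br true true A B = mx_anti A B.
  by rewrite /mx_anti /mx_br scaleN1r opprK.
by rewrite antiE /Xodd /Xeven; case: t y y'.
Qed.

Variable U : envelope L.

Definition env_mx (p : bool) A : U :=
  if p then env1 U (odd_elt A) else env0 U (Xeven t A).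

Lemma env_mx_linear p : linear (env_mx p).
Proof.
move=> k A B; rewrite /env_mx; case: p.
  by rewrite odd_elt_linear linearP.
by rewrite Xeven_linear linearP.
Qed.

Lemma env_mx_br p q A B : mx_dom t p A -> mx_dom t q B ->
  env_mx p A * env_mx q B - (-1) ^+ (p && q) *: (env_mx q B * env_mx p A) =
  env_mx (p (+) q) (mx_br p q A B).
Proof.
have [r00 r01 r11] := env_map U; move=> dA dB.
case: p dA => dA; case: q dB => dB; rewrite /env_mx /= ?expr0 ?expr1.
- by rewrite scaleN1r opprK -r11 br11_Xodd !XoddK.
- have -> : mx_br true false A B = - mx_br false true B A.
    by rewrite /mx_br !scale1r opprB.
  have o0 : odd_elt 0 = 0.
    by have := odd_elt_linear (-1) 0 0; rewrite scaler0 addr0 scaleN1r addNr.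
  have oN C : odd_elt (- C) = - odd_elt C.
    by have := odd_elt_linear (-1) C 0; rewrite !addr0 !scaleN1r o0 addr0.
  by rewrite oN raddfN /= -[X in mx_br _ _ _ X](XoddK dA) -Xodd_br01 odd_eltK r01 scale1r opprB.
- by rewrite scale1r -[X in mx_br _ _ _ X](XoddK dB) -Xodd_br01 odd_eltK r01.
- by rewrite scale1r -r00 br00_Xeven.
Qed.

Definition env_letter (a : letter t m) : U := env_mx (lpar a) (lmx K a).

Lemma env_mx_expand p A : mx_dom t p A ->
  env_mx p A = \sum_(a | lpar a == p) lcoord a A *: env_letter a.
Proof.
move=> dA; rewrite {1}(mx_expand dA) -[X in env_mx _ (X + _)]scale1r env_mx_linear.
rewrite scale1r [X in _ + X](_ : _ = 0) ?addr0; last first.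
  have z p' : env_mx p' 0 = 0.
    by have := env_mx_linear p' (-1) 0 0; rewrite scaler0 addr0 scaleN1r addNr.
  case: p dA => _; first by rewrite [X in X%:M]/= -scalemx1 scale0r z.
  rewrite [~~ false && _]/=; case: ifP => pr; last by rewrite -scalemx1 scale0r z.
  by rewrite /env_mx Xeven_scalar // raddf0.
rewrite (linear_comb _ _ _ _ (env_mx_linear p)).
by apply: eq_bigr => a /eqP <-.
Qed.

Lemma env_letter_rel a b :
  env_letter a * env_letter b -
    word_sign K (@lpar t m) a b *: (env_letter b * env_letter a) =
  \sum_k lbr K a b k *: env_letter k.
Proof.
rewrite /env_letter /word_sign env_mx_br; do ?exact: lmx_dom.
rewrite (env_mx_expand (@mx_br_dom _ _ _ _ _ _ _)) big_mkcond.
by apply: eq_bigr => k _; rewrite /lbr; case: ifP => //; rewrite scale0r.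
Qed.

Section Lift.
Variables (B : algType K) (g : letter t m -> B).
Hypothesis g_rel : forall a b,
  g a * g b - word_sign K (@lpar t m) a b *: (g b * g a) =
  \sum_k lbr K a b k *: g k.

Definition lift_mx (p : bool) A : B := \sum_(a | lpar a == p) lcoord a A *: g a.

Lemma lift_mx_linear p : linear (lift_mx p).
Proof.
move=> k A A'; rewrite /lift_mx scaler_sumr -big_split /=; apply: eq_bigr => a _.
by rewrite scalerA -scalerDl (lcoord_linear a k A A').
Qed.

Lemma lift_mx_lmx a : lift_mx (lpar a) (lmx K a) = g a.
Proof.
rewrite /lift_mx (bigD1 a) //= big1 ?addr0 => [|b /andP[/eqP ba nba]].
  by rewrite lcoord_lmx // eqxx scale1r.
by rewrite lcoord_lmx // (negbTE nba) scale0r.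
Qed.

Lemma lift_mx_scalar (s : K) : (s != 0 -> projective t) ->
  lift_mx false (s%:M : M) = 0.
Proof.
move=> sp; have [->|/sp pr] := eqVneq s 0.
  rewrite -scalemx1 scale0r; have := lift_mx_linear false (-1) 0 0.
  by rewrite scaler0 addr0 scaleN1r addNr.
rewrite /lift_mx big1 // => a /eqP pa; rewrite /lcoord pa pr /= !mxE eqxx.
case: eqP => [/eqP rc|_]; first by rewrite subrr scale0r.
by rewrite subr0 mulr0n scale0r.
Qed.

Lemma lift_mx_br p q A C : mx_dom t p A -> mx_dom t q C ->
  lift_mx (p (+) q) (mx_br p q A C) =
  lift_mx p A * lift_mx q C - (-1) ^+ (p && q) *: (lift_mx q C * lift_mx p A).
Proof.
move=> dA dC.
have br0l q' C' p' : mx_br p' q' 0 C' = 0 :> M.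
  by rewrite /mx_br mul0mx mulmx0 scaler0 subrr.
have br0r p' q' C' : mx_br p' q' C' 0 = 0 :> M.
  by rewrite /mx_br mul0mx mulmx0 scaler0 subrr.
have step1 (A' : M) : mx_dom t p A' -> mx_br p q A' C =
    \sum_(a : letter t m | lpar a == p) lcoord a A' *: mx_br p q (lmx K a) C.
  move=> dA'; rewrite {1}(mx_expand dA') -[X in mx_br _ _ (X + _)]scale1r.
  rewrite (mx_br_linearl p q C) scale1r (linear_comb _ _ _ _ (mx_br_linearl p q C)).
  rewrite [X in _ + X](_ : _ = 0) ?addr0 //.
  case: (p); first by rewrite [X in X%:M]/= -scalemx1 scale0r br0l.
  exact: mx_br_scalarl.
have step2 (A' : M) : mx_br p q A' C =
    \sum_(b : letter t m | lpar b == q) lcoord b C *: mx_br p q A' (lmx K b).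
  rewrite {1}(mx_expand dC) -[X in mx_br _ _ _ (X + _)]scale1r.
  rewrite (mx_br_linearr p q A') scale1r (linear_comb _ _ _ _ (mx_br_linearr p q A')).
  rewrite [X in _ + X](_ : _ = 0) ?addr0 //.
  case: (q); first by rewrite [X in X%:M]/= -scalemx1 scale0r br0r.
  exact: mx_br_scalarr.
rewrite step1 // (linear_comb _ _ _ _ (lift_mx_linear _)).
under eq_bigr => a _ do rewrite step2 (linear_comb _ _ _ _ (lift_mx_linear _)).
rewrite {2 3}/lift_mx mulr_suml mulr_sumr scaler_sumr -sumrB.
apply: eq_bigr => a /eqP pa.
rewrite /lift_mx mulr_sumr mulr_suml !scaler_sumr -sumrB.
apply: eq_bigr => b /eqP pb.
rewrite [X in _ *: (_ *: X)](_ : _ = g a * g b - (-1) ^+ (p && q) *: (g b * g a)).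
  rewrite -!scalerAl -!scalerAr !scalerBr !scalerA; congr (_ - _ *: _).
  by rewrite mulrC [lcoord a A * _]mulrC mulrA.
have := g_rel a b; rewrite /word_sign pa pb => ->.
rewrite big_mkcond; apply: eq_bigr => k _.
by rewrite /lbr pa pb; case: ifP => //; rewrite scale0r.
Qed.

(** Relations between letters suffice to map out of U: [lift_mx] turns them into a Lie superalgebra
    map, which is blind to the scalars lost in the projective types. *)
Lemma env_letter_lift : exists f : {lrmorphism U -> B},
  forall a, f (env_letter a) = g a.
Proof.
have lX A : lift_mx false (even_mx (Xeven t A)) = lift_mx false A.
  have [s -> /lift_mx_scalar s0] := even_mx_Xeven A.
  by rewrite -[A in LHS]scale1r lift_mx_linear s0 addr0 scale1r.
have j0l : linear (lift_mx false \o even_mx).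
  move=> k x x' /=; rewrite -{1}(even_mxK x) -{1}(even_mxK x') -Xeven_linear lX.
  exact: lift_mx_linear.
have j1l : linear (lift_mx true \o @Xodd K t N).
  by move=> k y y' /=; rewrite Xodd_linear lift_mx_linear.
pose j0 : {linear ls0 L -> B} := HB.pack (lift_mx false \o even_mx)
  (GRing.isLinear.Build K (ls0 L) B *:%R _ j0l).
pose j1 : {linear ls1 L -> B} := HB.pack (lift_mx true \o @Xodd K t N)
  (GRing.isLinear.Build K (ls1 L) B *:%R _ j1l).
have dF A : mx_dom t false A by [].
have jmap : lie_super_map j0 j1.
  split=> [x x'|x y|y y'] /=.
  - rewrite -{1}(even_mxK x) -{1}(even_mxK x') br00_Xeven lX.
    by rewrite (lift_mx_br (dF _) (dF _)) scale1r.
  - rewrite -{1}(even_mxK x) Xodd_br01.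
    by rewrite (lift_mx_br (dF _) (Xodd_dom y)) scale1r.
  - rewrite br11_Xodd lX (lift_mx_br (Xodd_dom y) (Xodd_dom y')).
    by rewrite scaleN1r opprK.
have [f [f0 f1]] := env_lift U jmap; exists f => a.
rewrite -(lift_mx_lmx a) /env_letter /env_mx; case pa: (lpar a).
  rewrite f1 /= XoddK // -pa; exact: lmx_dom.
by rewrite f0 /= lX.
Qed.

End Lift.
End QTypeBasis.

Local Open Scope classical_set_scope.
Local Open Scope ring_scope.

(** * The completion *)

Section RootLatticeEnum.
Variable n : nat.
Implicit Types nu : Qplus n.

(** Each coefficient is at most the height, so functions into ['I_k] reach every root combination of
    height below [k]. *)
Definition Qseq k : seq (Qplus n) :=
  [seq nu <- undup [seq [ffun i => val (f i)] | f : {ffun 'I_n.-1 -> 'I_k}] |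
    (height nu < k)%N].

Lemma Qseq_uniq k : uniq (Qseq k).
Proof. by rewrite filter_uniq ?undup_uniq. Qed.

Lemma mem_Qseq k nu : (nu \in Qseq k) = (height nu < k)%N.
Proof.
rewrite mem_filter mem_undup; case: ltnP => //= hk.
have nk i : (nu i < k)%N.
  by apply: leq_ltn_trans hk; rewrite /height (bigD1 i) //= leq_addr.
apply/mapP; exists [ffun i => Ordinal (nk i)]; first by rewrite mem_enum.
by apply/ffunP => i; rewrite !ffunE.
Qed.

Lemma fsbig_height (V : nmodType) k (F : Qplus n -> V) :
  \sum_(nu \in [set nu | (height nu < k)%N]) F nu = \sum_(nu <- Qseq k) F nu.
Proof.
rewrite (fsbig_seq _ _ (Qseq_uniq k)); apply: eq_fsbigl.
by apply/seteqP; split => nu /=; rewrite mem_Qseq.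
Qed.

Lemma Qseq_finite k : finite_set [set nu : Qplus n | (height nu < k)%N].
Proof.
suff -> : [set nu : Qplus n | (height nu < k)%N] = [set` Qseq k] by exact: finite_seq.
by apply/seteqP; split => nu /=; rewrite mem_Qseq.
Qed.

Definition height_part (V : nmodType) (F : Qplus n -> V) h : V :=
  \sum_(nu <- Qseq h.+1 | height nu == h) F nu.

Lemma sum_height_part (V : nmodType) (F : Qplus n -> V) k :
  \sum_(nu <- Qseq k) F nu = \sum_(h < k) height_part F h.
Proof.
have E (h : 'I_k) : height_part F h = \sum_(nu <- Qseq k | height nu == h) F nu.
  rewrite /height_part -big_filter -[RHS]big_filter; apply: perm_big.
  apply: uniq_perm => [||nu]; do ?[by apply: filter_uniq; exact: Qseq_uniq].
  by rewrite mem_filter [RHS]mem_filter !mem_Qseq; case: eqP => //= ->; rewrite ltnSn ltn_ord.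
under [RHS]eq_bigr => h _ do rewrite E big_mkcond.
rewrite exchange_big /= big_seq [RHS]big_seq; apply: eq_bigr => nu.
rewrite mem_Qseq => hk; rewrite (bigD1 (Ordinal hk)) //= eqxx big1 ?addr0 // => h hh.
case: eqP => // e; case/eqP: hh; exact/val_inj/esym.
Qed.
End RootLatticeEnum.

(** * Central elements of the completion *)

Section Completion.
Variables (K : numFieldType) (t : qtype) (m : nat).
Hypothesis rank_min : (qtype_min t <= m.+1)%N.
Local Notation N := m.+1.
Local Notation M := 'M[K]_N.
Variable U : envelope (qtype_alg K t N).
Local Notation X := (letter t m).
Local Notation par := (@lpar t m).
Local Notation e := (env_letter U).
Local Notation wspan := (wspan e).
Local Notation wprod := (word_prod e).
Local Notation std := (std par (@lrank t m)).
Local Notation wcoef := (wcoef par e (@lrank t m)).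
Local Notation isupper := (upper (@lrown t m) (@lcoln t m)).
Local Notation wnu := (wnu (@lrown t m) (@lcoln t m)).
Local Notation wheight := (wheight N (@lrown t m) (@lcoln t m)).
Local Notation lwt := (lwt (@lrown t m) (@lcoln t m)).
Implicit Types (nu : Qplus N) (u : Qplus N -> U) (x z : U) (w v : seq X).

Let Epar := @lbr_par K t m.
Let Erel := env_letter_rel U.
Let Elift := @env_letter_lift K t m U.
Let Ewt := @lbr_weight K t m.
Let Einj := @lrank_inj t m.
Let Eup := @lrank_upper t m.
Let C1 := word_coord_rel K (t := t) (m := m).
Let C2 := word_coord0 K (t := t) (m := m).
Let C3 := word_coord1 K (t := t) (m := m).

Let wsum := @wcoef_sum _ _ _ _ Epar _ _ Elift _ C1 C2 C3 (@lrank t m).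
Let wscale := @wcoefZ _ _ _ _ Epar _ _ Elift _ C1 C2 C3 (@lrank t m).
Let wword := @wcoef_wprod _ _ _ _ Epar _ _ Elift _ C1 C2 C3 (@lrank t m).
Let winj := @wcoef_inj _ _ _ _ Epar _ _ Elift _ C1 C2 C3 (@lrank t m).
Let wsupp := @wcoef_span _ _ _ _ Epar _ _ Elift _ C1 C2 C3 (@lrank t m).

Lemma env_parity_wprod w :
  env_parity U (wprod w) = (-1) ^+ (wpar par w) *: wprod w.
Proof.
have [p0 p1] := projT2 (cid (env_parity_subproof U)).
rewrite -/(env_parity U) in p0 p1.
have pe a : env_parity U (e a) = (-1) ^+ par a *: e a.
  rewrite /env_letter /env_mx; case: (par a); last by rewrite p0 scale1r.
  by rewrite p1 scaleN1r.
have pM x z : env_parity U (x * z) = env_parity U x * env_parity U z.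
  exact: rmorphM.
rewrite /word_prod; elim: w => [|a w IH].
  by rewrite !big_nil scale1r; exact: rmorph1.
rewrite !big_cons pM IH pe -scalerAl -scalerAr scalerA -signr_addb.
by rewrite /wpar /= oddD oddb.
Qed.

Definition ad_letter (a : X) (x : U) : U :=
  if par a then ad1 (odd_elt t (lmx K a)) x else ad0 (Xeven t (lmx K a)) x.

Lemma ad0_linear (y : ls0 (qtype_alg K t N)) : linear (ad0 (U := U) y).
Proof.
move=> k x z; rewrite /ad0 mulrDr mulrDl -scalerAr -scalerAl.
by rewrite opprD addrACA scalerBr.
Qed.

Lemma ad1_linear (y : ls1 (qtype_alg K t N)) : linear (ad1 (U := U) y).
Proof.
move=> k x z; rewrite /ad1 linearP mulrDr mulrDl -scalerAr -scalerAl.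
by rewrite opprD addrACA scalerBr.
Qed.

Lemma ad_letter_linear a : linear (ad_letter a).
Proof. by rewrite /ad_letter; case: (par a); [exact: ad1_linear|exact: ad0_linear]. Qed.

Lemma ad_letterE a w : ad_letter a (wprod w) = adw par e a (wpar par w) (wprod w).
Proof.
rewrite /ad_letter /adw; have : e a = env_mx U (par a) (lmx K a) by [].
rewrite /env_mx; case: (par a) => ->; last by rewrite scale1r.
by rewrite /ad1 env_parity_wprod -scalerAl.
Qed.

Definition ad_diag j (x : U) : U := ad0 (Xeven t (cut_mx K m j)) x.

Lemma ad_diag_linear j : linear (ad_diag j).
Proof. exact: ad0_linear. Qed.

Lemma ad_diagE j w : ad_diag j (wprod w) =
  (\sum_(a <- w) lwt j a)%:~R *: wprod w.
Proof.
rewrite /ad_diag /ad0 -[env0 U _]/(env_mx U false (cut_mx K m j)).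
set C := env_mx _ _ _.
have Ce a : C * e a = (lwt j a)%:~R *: e a + e a * C.
  have d0 : mx_dom t false (cut_mx K m j) by [].
  have := env_mx_br U d0 (@lmx_dom K t m a).
  rewrite scale1r -/C -/(e a) => /eqP; rewrite subr_eq => /eqP ->; congr (_ + _).
  rewrite [mx_br _ _ _ _]/mx_br -/(mx_br false false (cut_mx K m j) (lmx K a)).
  rewrite comm_cut_lmx; have := env_mx_linear U (par a) (lwt j a)%:~R (lmx K a) 0.
  have z0 : env_mx U (par a) 0 = 0.
    have := env_mx_linear U (par a) (-1) 0 0.
    by rewrite scaler0 addr0 scaleN1r addNr.
  by rewrite !addr0 z0 addr0.
rewrite /word_prod; elim: w => [|a w IH].
  by rewrite !big_nil mulr1 mul1r subrr scale0r.
move/eqP: IH; rewrite subr_eq => /eqP IH.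
rewrite !big_cons mulrA Ce mulrDl -mulrA IH mulrDr -!scalerAl -scalerAr.
by rewrite addrA mulrA addrK intrD scalerDl.
Qed.

Lemma upper_coord (A : M) (a : X) :
  strict_upper A -> lcoord a A != 0 -> isupper a.
Proof.
move=> Au; apply: contraNT; rewrite /upper -leqNgt => ca.
by rewrite /lcoord Au // Au // if_same subrr.
Qed.

Lemma nonupper_coord (A : M) (a : X) :
  diag_mat A \/ strict_lower A -> lcoord a A != 0 -> ~~ isupper a.
Proof.
move=> dA; apply: contraNN => ua; have rc : lrow a != lcol a.
  by apply: contraTneq ua => E; rewrite /upper /lrown E ltnn.
rewrite /lcoord (negbTE rc) !andbF subr0.
by case: dA => ->; rewrite // ltnW.
Qed.

Lemma Ximage_span (P : M -> Prop) (C : pred X) :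
  (forall (A : M) (a : X), P A -> lcoord a A != 0 -> C a) ->
  forall x, @Ximage K t N U P x -> wspan (fun w => all C w) x.
Proof.
move=> PC x.
have key p A : P A -> mx_dom t p A -> wspan (fun w => all C w) (env_mx U p A).
  move=> PA dA; rewrite (env_mx_expand U dA); apply: wspan_sum => a _ _.
  have [->|c0] := eqVneq (lcoord a A) 0; first by rewrite scale0r; exact: wspan0.
  apply: wspanZ; rewrite (_ : e a = wprod [:: a]); last by rewrite /word_prod big_seq1.
  by apply: wspan_wprod; rewrite /= (PC _ _ PA c0).
case=> [[A PA <-]|[y Py <-]]; first exact: (key false A PA).
have := key true (Xodd y) Py (@Xodd_dom K t m y).
by rewrite /env_mx odd_eltK.
Qed.

Lemma gen_alg_span (G : set U) (C : pred X) :
  (forall x, G x -> wspan (fun w => all C w) x) ->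
  forall x, gen_alg G x -> wspan (fun w => all C w) x.
Proof.
move=> GC x; elim=> [z /GC //||x1 x2 _ s1 _ s2|k x1 _ s1|x1 x2 _ s1 _ s2].
- by rewrite (_ : 1 = wprod [::]); [exact: wspan_wprod | rewrite /word_prod big_nil].
- exact: wspanD.
- exact: wspanZ.
- by apply: wspanM s1 s2 => v w; rewrite all_cat => -> ->.
Qed.

Lemma wspan_trans (P Q : seq X -> Prop) x :
  (forall w, P w -> wspan Q (wprod w)) -> wspan P x -> wspan Q x.
Proof.
move=> PQ [l lP ->]; rewrite /lin; apply: wspan_sum => p /lP/PQ pQ _.
exact: wspanZ.
Qed.

Lemma U_bminus_span x : @U_bminus K t N U x ->
  wspan (fun w => std w /\ all (predC isupper) w) x.
Proof.
have G z : @Ximage K t N U (@diag_mat K N) z \/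
    @Ximage K t N U (@strict_lower K N) z ->
    wspan (fun w => all (predC isupper) w) z.
  by case; apply: Ximage_span => A a dA; apply: nonupper_coord; [left | right].
move=> /(gen_alg_span G); apply: wspan_trans => w.
exact: (straighten_nonupper Erel Einj Ewt).
Qed.

Lemma U_nplus_span x : @U_nplus K t N U x ->
  wspan (fun w => std w /\ all isupper w) x.
Proof.
move=> /(gen_alg_span (Ximage_span upper_coord)); apply: wspan_trans => w wu.
by apply: wspanW (straighten_upper Erel Einj Ewt wu) => v [? []].
Qed.

Lemma wcoef_ad_diag j x w : wspan std x ->
  wcoef (ad_diag j x) w = (\sum_(a <- w) lwt j a)%:~R * wcoef x w.
Proof.
move=> [l ls ->]; rewrite /lin (linear_comb _ _ _ _ (ad_diag_linear j)).
rewrite !wsum ?mulr_sumr; first last.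
- by move=> p /ls ps _; apply: wspanZ; rewrite ad_diagE; apply: wspanZ; exact: wspan_wprod.
- by move=> p /ls ps _; apply: wspanZ; exact: wspan_wprod.
rewrite big_seq [RHS]big_seq; apply: eq_bigr => p /ls ps.
have ws : wspan std (wprod p.2) by exact: wspan_wprod.
rewrite ad_diagE !wscale ?wword //; last exact: wspanZ.
by case: eqVneq => [->|_]; rewrite ?mulr0 ?mulr1 // mulrC.
Qed.

(** The cut matrices are dual to the simple roots. *)
Lemma weight_cut nu (j : 'I_m) : weight nu (cut_mx K m j) = (nu j)%:R.
Proof.
rewrite /weight (bigD1 j) //= big1 => [|i ij]; rewrite !mxE !eqxx /=.
  by rewrite leqnn ltnn subr0 addr0.
rewrite ltn_neqAle -val_eqE /= in ij *.
by rewrite ij; case: leqP; rewrite ?subrr ?mul0rn //= subrr mul0rn.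
Qed.

Definition graded nu w := std w /\ forall j : 'I_m, wnu w j = nu j.

(** A word with nonzero coefficient must share the eigenvalues of [x] under the cut matrices, and
    these determine its weight. *)
Lemma U_nplus_weight_span nu x : @U_nplus_weight K t N U nu x ->
  wspan (fun w => graded nu w /\ all isupper w) x.
Proof.
move=> [xn xw]; have xs := U_nplus_span xn.
apply: wspanW (wspan_coef Epar Elift C1 C2 C3 (fun _ => @proj1 _ _) xs).
move=> w [[ws wu] w0]; split=> //; split=> // j.
have dc : diag_mat (cut_mx K m j) by move=> i k ik; rewrite mxE (negbTE ik).
have xstd : wspan std x by apply: wspanW xs => v [].
have := congr1 (wcoef^~ w) (xw _ dc).
rewrite -/(ad_diag j x) wcoef_ad_diag // weight_cut wscale //.
move/(mulIf w0)/eqP; rewrite -[(nu j)%:R]/((nu j)%:Z%:~R) eqr_int => /eqP E.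
apply/eqP; rewrite -eqz_nat -E /wnu (big_morph Posz PoszD (erefl _)).
rewrite big_seq [X in _ == X]big_seq; apply/eqP/eq_bigr => a /(allP wu) ua.
by rewrite lwt_upper // ua.
Qed.

(** [wheight] sums over [m.+1] indices although there are only [m] simple roots; the extra one
    contributes nothing. *)
Lemma wnu_last w : wnu w m = 0%N.
Proof.
rewrite /wnu big1 // => a _; rewrite (_ : (_ <= m < _)%N = false) ?andbF //.
by apply/negbTE; rewrite negb_and -leqNgt (ltn_ord (lcol a) : (_ <= m)%N) orbT.
Qed.

Lemma graded_height nu w : graded nu w -> wheight w = height nu.
Proof.
move=> [_ wn]; rewrite /wheight big_ord_recr /= wnu_last addn0 /height.
by apply: eq_bigr => j _; rewrite wn.
Qed.

Lemma Jprime_span nu x : @Jprime K t N U nu x -> wspan (graded nu) x.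
Proof.
move=> [k [b [a [bb aa ->]]]]; apply: wspan_sum => i _ _.
apply: (wspanM _ (U_bminus_span (bb i)) (U_nplus_weight_span (aa i))).
move=> v w [sv vl] [[sw wn] wu]; split; first exact: (std_cat Eup).
by move=> j; rewrite wnu_cat wnu_nonupper // wn.
Qed.

Lemma hat_sum_seq u r : uniq r -> (forall nu, u nu != 0 -> nu \in r) ->
  \sum_(nu \in [set: Qplus N]) u nu = \sum_(nu <- r) u nu.
Proof.
move=> ru ur; rewrite (fsbigE r) //; last first.
  by move=> nu _ nr; apply/eqP; apply: contraNT nr; exact: ur.
by apply: eq_bigl => nu; rewrite in_setT.
Qed.

Lemma hat_embed_seq x u : hat_embed x u -> exists r : seq (Qplus N),
  [/\ uniq r, forall nu, u nu != 0 -> nu \in r & x = \sum_(nu <- r) u nu].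
Proof.
move=> [_ /finite_seqP[r rE] ->]; exists (undup r).
have ur nu : u nu != 0 -> nu \in undup r.
  by move=> u0; rewrite mem_undup; have : [set` r] nu by rewrite -rE.
by split; rewrite ?undup_uniq // -hat_sum_seq ?undup_uniq.
Qed.

Lemma graded_std nu x : wspan (graded nu) x -> wspan std x.
Proof. by apply: wspanW => w []. Qed.

Lemma hat_embed_span x u : hat_embed x u -> wspan std x.
Proof.
move=> xu; have [hu _ _] := xu; have [r [_ _ ->]] := hat_embed_seq xu.
by apply: wspan_sum => nu _ _; exact: graded_std (Jprime_span (hu nu)).
Qed.

(** A word occurs only in the component named by its upper part, whose height is that of the
    word. *)
Lemma hat_embed_coef0 x u k w : hat_embed x u ->
  (forall nu, (height nu < k)%N -> u nu = 0) -> (wheight w < k)%N ->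
  wcoef x w = 0.
Proof.
move=> xu u0 wk; have [hu _ _] := xu; have [r [_ _ ->]] := hat_embed_seq xu.
have us nu : wspan (graded nu) (u nu) := Jprime_span (hu nu).
rewrite wsum => [|nu _ _]; last exact: graded_std (us nu).
rewrite big1 // => nu _; apply/eqP/negPn/negP => c0.
have gw := wsupp (fun _ => @proj1 _ _) (us nu) c0.
move: c0; rewrite u0 -?(graded_height gw) //.
by rewrite (wcoef0 Epar Elift C1 C2 C3) eqxx.
Qed.

Lemma hat_truncE k u : hat_trunc k u = \sum_(h < k) height_part u h.
Proof. by rewrite /hat_trunc fsbig_height sum_height_part. Qed.

Lemma hat_trunc_embed u k : hatU U u ->
  (forall nu, (k <= height nu)%N -> u nu = 0) ->
  hat_embed (hat_trunc k u) u /\ forall l, (k <= l)%N -> hat_trunc l u = hat_trunc k u.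
Proof.
move=> hu u0; have uk l nu : (k <= l)%N -> u nu != 0 -> nu \in Qseq N l.
  by move=> kl; apply: contraNT; rewrite mem_Qseq -leqNgt => /(leq_trans kl)/u0 ->.
have E l : (k <= l)%N -> hat_trunc l u = \sum_(nu \in [set: Qplus N]) u nu.
  move=> kl; rewrite /hat_trunc fsbig_height (hat_sum_seq (Qseq_uniq N l)) // => nu.
  exact: uk.
split; last by move=> l kl; rewrite !E.
split=> //; last by rewrite E.
apply: (sub_finite_set _ (Qseq_finite N k)) => nu /= /(uk _ _ (leqnn k)).
by rewrite mem_Qseq.
Qed.

Lemma projective_rank : projective t -> (2 < N)%N.
Proof. by move: rank_min; rewrite /projective; case: t. Qed.

(** [graded_finite] applied to the sums of the components of equal height. *)
Lemma hat_center_bounded u : hat_center U u ->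
  exists k, forall nu, (k <= height nu)%N -> u nu = 0.
Proof.
move=> [hu u0 u1].
have us nu : wspan (graded nu) (u nu) := Jprime_span (hu nu).
have S_span h : wspan (fun w => std w /\ wheight w = h) (height_part u h).
  apply: wspan_sum => nu _ /eqP <-; apply: wspanW (us nu) => w gw.
  by split; [exact: (proj1 gw) | exact: graded_height gw].
have van T : hat_extends T u (fun=> 0) ->
    vanishes par e (@lrank t m) N (@lrown t m) (@lcoln t m) (height_part u) T.
  move=> [_ cv] k; have [n Hn] := cv k; exists n => l nl w _ wk.
  have [v ev v0] := Hn l nl; rewrite -hat_truncE.
  exact: hat_embed_coef0 ev v0 wk.
have vl a : isupper a -> vanishes par e (@lrank t m) N (@lrown t m) (@lcoln t m)
    (height_part u) (ad_letter a).
  move=> _; apply: van; rewrite /ad_letter.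
  by case: (par a); [exact: u1 | exact: u0].
have vd j : vanishes par e (@lrank t m) N (@lrown t m) (@lcoln t m)
    (height_part u) (ad_diag j).
  by apply: van; exact: u0.
have lrN (a : X) : (lrown a < N)%N := ltn_ord (lrow a).
have opp (y : X) := @letter_opposite K t m y projective_rank.
have [k Hk] := graded_finite Epar Erel Elift C1 C2 C3 Einj (@letter_inj t m) lrN
  Ewt Eup ad_letter_linear ad_diag_linear ad_letterE ad_diagE opp S_span vl vd.
exists k => nu kn; apply: winj; first exact: graded_std (us nu).
move=> w; apply/eqP/negPn/negP => c0.
have gw := wsupp (fun _ => @proj1 _ _) (us nu) c0.
have := Hk _ kn w; rewrite /height_part wsum => [|nu' _ _]; last first.
  exact: graded_std (us nu').
rewrite -big_filter (bigD1_seq nu) /=; first last.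
- by apply: filter_uniq; exact: Qseq_uniq.
- by rewrite mem_filter eqxx; exact: etrans (mem_Qseq _ _) (ltnSn _).
rewrite big1 ?addr0; first by move/eqP; apply/negP.
(* Components of equal height cannot cancel: a word determines its [nu]. *)
move=> nu' nn; apply/eqP/negPn/negP => c1.
have [_ gw'] := wsupp (fun _ => @proj1 _ _) (us nu') c1.
case/eqP: nn; apply/ffunP => j.
by rewrite -gw'; case: gw => _ ->.
Qed.

Lemma hat_center_sub u : hat_center U u ->
  exists2 x, env_center U x & hat_embed x u.
Proof.
move=> uc; have [k u0] := hat_center_bounded uc.
have [hu c0 c1] := uc; have [xu xl] := hat_trunc_embed hu u0.
exists (hat_trunc k u) => //.
have key T : hat_extends T u (fun=> 0) -> T (hat_trunc k u) = 0.
  move=> [_ cv].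
  (* Beyond [k] the truncations are constant, so a single element is approximated by zero to every
     order. *)
  have emb l : exists2 v, hat_embed (T (hat_trunc k u)) v &
      forall nu, (height nu < l)%N -> v nu = 0.
    have [n Hn] := cv l; rewrite -(xl (n + k)%N) ?leq_addl //.
    exact: (Hn _ (leq_addr _ _)).
  apply: winj => [|w]; first by have [v /hat_embed_span] := emb 0%N.
  have [v ev v0] := emb (wheight w).+1.
  exact: hat_embed_coef0 ev v0 (ltnSn _).
by split=> y; apply: key.
Qed.

Lemma hat_center_sup u x : env_center U x -> hat_embed x u -> hat_center U u.
Proof.
move=> [x0 x1] xu; have [hu _ xE] := xu.
have [r [ru ur xr]] := hat_embed_seq xu.
(* The successor puts the bound strictly above every height in the support. *)
have uk nu : (\max_(nu <- r) (height nu).+1 <= height nu)%N -> u nu = 0.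
  move=> kn; apply/eqP; apply: contraTT kn => /ur nr.
  by rewrite -ltnNge (big_rem nu) //= leq_max leqnn.
have [_ xl] := hat_trunc_embed hu uk; set k := (\max_(_ <- _) _)%N in uk xl.
have xk : hat_trunc k u = x.
  have [[_ _ ->] _] := hat_trunc_embed hu uk; exact: esym.
have zero_hat : hatU U (fun=> 0 : U).
  move=> nu; exists 0%N, (fun=> 0), (fun=> 0).
  by split=> [[]//|[]//|]; rewrite big_ord0.
have emb0 : hat_embed (0 : U) (fun=> 0).
  split=> //; last by rewrite fsbig1.
  by rewrite (_ : [set _ | _] = set0) //; apply/seteqP; split => nu //=; rewrite eqxx.
have key T : T x = 0 -> hat_extends T u (fun=> 0).
  move=> Tx; split=> // l; exists k => n kn; exists (fun=> 0) => //.
  by rewrite xl // xk Tx.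
by split=> // y; apply: key.
Qed.

End Completion.

Theorem corollary12p2p2 (R : realType) (t : qtype) (n : nat)
    (hn : (qtype_min t <= n)%N) (U : envelope (qtype_alg R[i]%C t n)) :
  hat_center U =
  [set u | exists2 x, env_center U x & hat_embed x u].
Proof.
(* The rank bound excludes 0, and the letters are indexed by [m.+1]. *)
case: n hn U => [|m] hn U; first by case: t hn U.
apply/seteqP; split => u; first exact: hat_center_sub.
by move=> [x]; exact: hat_center_sup.
Qed.
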